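(* Let $M_1,\dots,M_k$ be matroids on a common ground set $N$ and let $\mathcal{A}$ be an $\alpha$-competitive algorithm for the (linear-weight) Matroid Intersection Secretary Problem on the intersection of $M_1,\dots,M_k$. Then $\mathcal{A}$ can be transformed into an $\frac{\alpha^2}{128k^2}$-competitive secretary algorithm for maximizing a nonnegative submodular function $f$ over the intersection of the same matroids. Moreover, if $\mathcal{A}$ is order-oblivious, then so is the transformed algorithm.
   Context: Secretary model: elements of $N$ arrive one by one in uniformly random order and the algorithm must irrevocably decide upon each arrival whether to select it; the selected set must be independent in every $M_i$. In the linear version each element reveals a nonnegative weight on arrival and an algorithm is $\alpha$-competitive if the expected total weight selected is at least $\alpha$ times the maximum weight of a common independent set. In the submodular version the objective is a nonnegative submodular function $f\colon 2^N\to\mathbb{R}_{\ge0}$ (i.e. $f(A)+f(B)\ge f(A\cup B)+f(A\cap B)$), accessible by a value oracle that may be queried on subsets of already-revealed elements; an algorithm is $c$-competitive if the expected value $f$ of its output is at least $c\cdot f(\mathrm{OPT})$, where $\mathrm{OPT}$ maximizes $f$ over the common independent sets. Order-oblivious means the algorithm works in the order-oblivious secretary model: it first requests a uniformly random sample of a chosen number $m$ of elements (which it cannot select), and then must perform against an adversarial arrival order of the remaining elements. *)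

(* Defs.v *)
From HB Require Import structures.
From mathcomp Require Import all_boot all_order all_algebra perm.
From mathcomp Require Import reals constructive_ereal measure probability.

Set Implicit Arguments.
Unset Strict Implicit.
Unset Printing Implicit Defensive.

Import Order.TTheory GRing.Theory Num.Theory.
Local Open Scope ring_scope.

Record matroid (N : finType) := Matroid {
  indep :> pred {set N};
  indep0 : indep set0;
  indep_sub : forall I J : {set N}, I \subset J -> indep J -> indep I;
  indep_aug : forall I J : {set N}, indep I -> indep J -> (#|I| < #|J|)%N ->
    exists2 u, u \in J :\: I & indep (u |: I)
}.

Definition common_indep (N : finType) (k : nat) (M : 'I_k -> matroid N)
    (I : {set N}) : Prop :=
  forall i, M i I.

(* A type of secretary instances on the ground set N.  [reveal S x] is what is
   known of the instance x once exactly the elements of S have arrived. *)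
Record objective (R : realType) (N : finType) := Objective {
  instance : Type;
  valid : instance -> Prop;
  reveal : {set N} -> instance -> instance;
  value : instance -> {set N} -> R
}.

Definition linear_objective (R : realType) (N : finType) : objective R N :=
  {| instance := N -> R;
     valid := fun w => forall u, 0 <= w u;
     reveal := fun S w u => if u \in S then w u else 0;
     value := fun w I => \sum_(u in I) w u |}.

Definition submodular (R : realType) (N : finType) (f : {set N} -> R) : Prop :=
  forall A B : {set N}, f (A :|: B) + f (A :&: B) <= f A + f B.

(* The value oracle can be queried only on subsets of the set S of revealed
   elements: a query X is answered by f (X :&: S). *)
Definition submodular_objective (R : realType) (N : finType) : objective R N :=
  {| instance := {set N} -> R;
     valid := fun f => (forall X, 0 <= f X) /\ submodular f;
     reveal := fun S f X => f (X :&: S);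
     value := fun f I => f I |}.

(* A randomized online algorithm.  Its random bits are a point t of an arbitrary
   probability space.  [select t s y] decides on the last element of the sequence
   s of the elements arrived so far, y being the revealed part of the instance.
   Earlier decisions are not an argument, as t, s and y determine them. *)
Record secretary_alg (R : realType) (N : finType) (O : objective R N) :=
  SecretaryAlg {
    seed_disp : measure_display;
    seed : measurableType seed_disp;
    seed_law : probability seed R;
    select : seed -> seq N -> instance O -> bool;
    measurable_select : forall s y,
      measurable_fun (@classical_sets.setT seed) (fun t => select t s y)
  }.

Definition is_order (N : finType) (s : seq N) : bool := perm_eq s (enum N).

Definition output (R : realType) (N : finType) (O : objective R N)
    (A : secretary_alg O) (t : seed A) (x : instance O) (s : seq N) : {set N} :=
  [set u | let arrived := take (index u s).+1 s in
           select t arrived (reveal [set v in arrived] x)].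

Definition order_of (N : finType) (sigma : {perm N}) : seq N :=
  [seq sigma u | u <- enum N].

(* Expected value of the output when a uniformly random order s, independent of
   the random bits t, is replaced by [reorder t s] before being presented. *)
Definition expected_value (R : realType) (N : finType) (O : objective R N)
    (A : secretary_alg O) (x : instance O) (reorder : seed A -> seq N -> seq N) :
    \bar R :=
  expectation (seed_law A) (fun t =>
    (\sum_(sigma : {perm N}) value x (output t x (reorder t (order_of sigma))))
      / #|{perm N}|%:R).

Definition is_opt (R : realType) (N : finType) (k : nat) (M : 'I_k -> matroid N)
    (O : objective R N) (x : instance O) (OPT : {set N}) : Prop :=
  common_indep M OPT /\
  forall I : {set N}, common_indep M I -> value x I <= value x OPT.

Definition feasible (R : realType) (N : finType) (k : nat)
    (M : 'I_k -> matroid N) (O : objective R N) (A : secretary_alg O) : Prop :=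
  forall x, valid x -> forall (t : seed A) s, is_order s ->
    common_indep M (output t x s).

Definition competitive (R : realType) (N : finType) (k : nat)
    (M : 'I_k -> matroid N) (O : objective R N) (c : R) (A : secretary_alg O) :
    Prop :=
  feasible M A /\
  forall x, valid x -> forall OPT, is_opt M x OPT ->
    ((c * value x OPT)%:E <= expected_value x (fun (_ : seed A) s => s))%E.

(* The adversary sees the sample, i.e. the first m elements of a uniformly random
   order, and then fixes the order of all the remaining elements. *)
Definition adversary (N : finType) (adv : seq N -> seq N) : Prop :=
  forall p : seq N, perm_eq (adv p) [seq u <- enum N | u \notin p].

(* c-competitiveness in the order-oblivious model.  The size [m t] of the sample
   may be random, but it is chosen before anything is revealed: it depends on the
   random bits only. *)
Definition order_oblivious (R : realType) (N : finType) (k : nat)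
    (M : 'I_k -> matroid N) (O : objective R N) (c : R) (A : secretary_alg O) :
    Prop :=
  feasible M A /\
  exists m : seed A -> nat,
    [/\ measurable_fun (@classical_sets.setT (seed A)) m,
        forall t, (m t <= #|N|)%N,
        forall x, valid x -> forall t s, is_order s ->
          [disjoint output t x s & take (m t) s] &
        forall x, valid x -> forall OPT, is_opt M x OPT ->
        forall adv, adversary adv ->
          ((c * value x OPT)%:E <=
             expected_value x (fun t s => take (m t) s ++ adv (take (m t) s)))%E].

(* Main.v *)
Require Import Defs.
From HB Require Import structures.
From mathcomp Require Import all_boot all_order all_algebra perm.
From mathcomp Require Import reals constructive_ereal measure probability.
From mathcomp Require Import ring lra.
From mathcomp Require boolp classical_sets functions cardinality.
From mathcomp Require measurable_realfun numfun lebesgue_integral interval_inference.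

(** Greedy on a random half [L] of the elements yields prices: an element [u] that
    greedy on [L + u] would pick is worth its marginal value [w u] over the sample
    elements picked before it. The linear algorithm is run on these prices, after
    thinning: an element outside [L] is selectable only if an independent coin of
    probability [r = alpha / (4 k)] allows it.

    Since whether [u] is picked, and its price, do not depend on whether [u] itself
    is in [L] or passes its coin, sums over the picked elements of [L], and over the
    selectable ones, have expectations in the ratio [1 : r]. This compares the total
    price [W] of all picked elements with (i) the greedy value [f M], hence with the
    optimum through [1/2 f OPT <= E f (OPT :|: M)] and the usual charging argument
    for [k] matroids; (ii) the best independent set of selectable elements, which
    first-fit shows to be worth at least about [r W / 2]; (iii) the loss incurred by
    replacing [f] by the linear function [w], which is only of order
    [r ^+ 2 * (W + f set0)]. As the linear algorithm gets an [alpha] fraction of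
    (ii), this choice of [r] leaves a value of order [alpha ^+ 2 / k ^+ 2].

    Online, the linear algorithm must see a uniformly random order independent of
    its prices: the sample consists of the first elements to arrive, and they are
    put back at random positions between the later ones. This costs nothing in the
    order-oblivious model either, because the prefix requested by the linear
    algorithm is made of the sample and of a prefix of the remaining elements. *)

Set Implicit Arguments.
Unset Strict Implicit.
Unset Printing Implicit Defensive.

Import Order.TTheory GRing.Theory Num.Theory.
Local Open Scope ring_scope.

(** * Averaging and sampling inequalities *)

(** For nonnegative terms, a sum is the integral over thresholds of the number of terms above them,
    so comparing counts compares sums. The induction peels off the layer below the least value of
    [a]; if that value is not positive, dropping its index only raises the left side. *)
Lemma layer_cake_le (R : realFieldType) (T T' : finType) (m : nat)
    (X : {set T}) (Y : {set T'}) (a : T -> R) (b : T' -> R) :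
  (forall y, y \in Y -> 0 <= b y) ->
  (forall theta : R, 0 < theta ->
     (#|[set x in X | (theta <= a x)%R]| <= m * #|[set y in Y | (theta <= b y)%R]|)%N) ->
  \sum_(x in X) a x <= m%:R * \sum_(y in Y) b y.
Proof.
have [n] := ubnP #|X|; elim: n X Y a b => // n IH X Y a b cX b0 le_card.
have [->|[x xX]] := set_0Vmem X.
  by rewrite big_set0 mulr_ge0 ?ler0n ?sumr_ge0.
have [x0 x0X min_x0] : exists2 x0, x0 \in X & forall y, y \in X -> a x0 <= a y.
  by have [x0 x0X min_x0] := arg_minP a xX; exists x0.
have cX' : (#|X :\ x0| < n)%N by move: cX; rewrite (cardsD1 x0) x0X.
have [ax0|ax0] := leP (a x0) 0.
  rewrite (big_setD1 x0) //=.
  have := IH (X :\ x0) Y a b cX' b0.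
  suff H (theta : R) : 0 < theta -> (#|[set x1 in X :\ x0 | (theta <= a x1)%R]| <=
      m * #|[set y in Y | (theta <= b y)%R]|)%N by move=> /(_ H); lra.
  move=> /le_card; apply: leq_trans; apply: subset_leq_card.
  by apply/subsetP => z; rewrite !inE => /andP[/andP[_ ->]].
pose Y' := [set y in Y | (a x0 <= b y)%R].
have cardX : #|X|%:R <= m%:R * #|Y'|%:R :> R.
  rewrite -natrM ler_nat; have := le_card _ ax0.
  congr (_ <= _)%N; apply: eq_card => z; rewrite !inE.
  by case zX : (z \in X) => //=; apply: min_x0.
have -> : \sum_(x in X) a x = a x0 * #|X|%:R + \sum_(x in X :\ x0) (a x - a x0).
  rewrite (big_setD1 x0) //= sumrB sumr_const (cardsD1 x0 X) x0X.
  by rewrite natrD -mulr_natr /=; ring.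
have leY : a x0 * #|Y'|%:R + \sum_(y in Y') (b y - a x0) <= \sum_(y in Y) b y.
  rewrite sumrB sumr_const -[a x0 *+ _]mulr_natr subrKC.
  rewrite [leRHS](big_setID Y') /= (setIidPr _); last first.
    by apply/subsetP => y; rewrite inE => /andP[].
  by rewrite lerDl sumr_ge0 // => y; rewrite inE => /andP[_ /b0].
(* Lowering both functions by [a x0] shifts all thresholds by the same amount. *)
have := IH (X :\ x0) Y' (fun x => a x - a x0) (fun y => b y - a x0) cX'.
have H1 y : y \in Y' -> 0 <= b y - a x0 by rewrite inE subr_ge0 => /andP[].
have H2 (theta : R) : 0 < theta -> (#|[set x1 in X :\ x0 | (theta <= a x1 - a x0)%R]| <=
      m * #|[set y in Y' | (theta <= b y - a x0)%R]|)%N.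
  move=> theta0; have := le_card (theta + a x0) (addr_gt0 theta0 ax0).
  have -> : [set y in Y' | (theta <= b y - a x0)%R] = [set y in Y | (theta + a x0 <= b y)%R].
    apply/setP => y; rewrite !inE lerBrDr -andbA; congr (_ && _).
    by apply: andb_idl => H; apply: le_trans H; rewrite lerDr ltW.
  apply: leq_trans; apply: subset_leq_card.
  by apply/subsetP => z; rewrite !inE lerBrDr => /andP[/andP[_ ->]].
move=> /(_ H1 H2) le_IH.
have m0 : 0 <= m%:R :> R by rewrite ler0n.
have := ler_wpM2l (ltW ax0) cardX; have := ler_wpM2l m0 leY.
by rewrite mulrDr; lra.
Qed.

(* A variant of the Feige-Mirrokni-Vondrak sampling lemma in which the elements
   need not be sampled independently.  The extra term in [l] makes it provable
   by removing from [S] the element with the least marginal probability. *)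
Lemma sampling_ge (R : realFieldType) (Omega N : finType) (mu : Omega -> R)
    (A : Omega -> {set N}) (g : {set N} -> R) (r l : R) (S : {set N}) :
  (forall w, 0 <= mu w) -> \sum_w mu w = 1 -> (forall X, 0 <= g X) ->
  (forall X Y, g (X :|: Y) + g (X :&: Y) <= g X + g Y) ->
  (forall u, u \in S -> l <= \sum_(w | u \in A w) mu w <= r) -> l <= r ->
  (1 - r) * g set0 + l * g S <= \sum_w mu w * g (A w :&: S).
Proof.
move=> mu0 mu1 g0 gsub; have [n] := ubnP #|S|; elim: n S l => // n IH S l cS lr lr'.
have [->|[x xS]] := set_0Vmem S.
  under eq_bigr do rewrite setI0.
  by rewrite -mulr_suml mu1 -mulrDl ler_wpM2r //; lra.
pose pr u := \sum_(w | u \in A w) mu w.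
have [u uS min_u] : exists2 u, u \in S & forall v, v \in S -> pr u <= pr v.
  by have [u uS min_u] := arg_minP pr xS; exists u.
have /andP[lu ur] := lr u uS.
have cS' : (#|S :\ u| < n)%N by move: cS; rewrite (cardsD1 u) uS.
have H v : v \in S :\ u -> pr u <= pr v <= r.
  by rewrite inE => /andP[_ vS]; rewrite min_u //=; have /andP[] := lr v vS.
(* With the least probability as the new lower bound, the terms [pr u * g (S :\ u)] cancel against
   [step] and leave [pr u * g S], which is at least [l * g S]. *)
have {IH} := IH (S :\ u) (pr u) cS' H ur.
have step : \sum_w mu w * g (A w :&: (S :\ u)) + pr u * (g S - g (S :\ u)) <=
    \sum_w mu w * g (A w :&: S).
  rewrite /pr mulr_suml [X in _ + X]big_mkcond /= -big_split /=.
  apply: ler_sum => w _; case: ifP => uA; last first.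
    rewrite addr0 ler_wpM2l //; rewrite le_eqVlt; apply/orP; left; apply/eqP; congr g.
    by apply/setP => v; rewrite !inE; case: eqP => // ->; rewrite uA.
  rewrite -mulrDr ler_wpM2l //.
  have := gsub (S :\ u) (A w :&: S).
  have -> : (S :\ u) :|: (A w :&: S) = S.
    apply/setP => v; rewrite !inE; case: eqP => [->|_]; rewrite ?uA ?uS //=.
    by case: (v \in S); rewrite ?andbF.
  have -> : (S :\ u) :&: (A w :&: S) = A w :&: (S :\ u).
    by apply/setP => v; rewrite !inE; case: (v \in S); rewrite ?andbF ?andbT // andbC.
  lra.
have gS : (pr u - l) * g S >= 0 by rewrite mulr_ge0 // subr_ge0.
move: step gS; rewrite mulrBl mulrBr; by move: (pr u) => p; lra.
Qed.

(** * Independent coins and sums over random sets *)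

Section Bernoulli.
Variables (R : realFieldType) (N : finType).
Implicit Types (c L : {set N}) (u v : N).

Definition bern (r : R) c : R := \prod_u (if u \in c then r else 1 - r).

Lemma bern_ge0 r c : 0 <= r <= 1 -> 0 <= bern r c.
Proof. by move=> /andP[r0 r1]; apply: prodr_ge0 => u _; case: ifP; lra. Qed.

Lemma sum_bern r : \sum_c bern r c = 1.
Proof.
have := @bigA_distr R 0 1 *%R +%R _ (fun _ : N => r) (fun _ => 1 - r).
rewrite /= big1 => [->|u _]; last exact: subrKC.
by apply: eq_bigl => c; rewrite inE.
Qed.

(** The law of the sample is uniform on subsets, hence invariant under permuting the elements. *)
Lemma bern_half c : bern 2^-1 c = (2 ^ #|N|)%:R^-1.
Proof.
rewrite /bern (eq_bigr (fun _ => 2^-1)); last by move=> u _; case: ifP => _; field.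
by rewrite prodr_const natrX exprVn.
Qed.

Definition agree_off u c c' := forall v, v != u -> (v \in c) = (v \in c').

(** Toggling [u] pairs the sets containing it with those that do not; [phi] and the weight [B] of
    the other coins agree on each pair. *)
Lemma sum_bern_in r u (phi : {set N} -> R) :
  (forall c c', agree_off u c c' -> phi c = phi c') ->
  \sum_c bern r c * ((u \in c)%:R * phi c) = r * \sum_c bern r c * phi c.
Proof.
move=> inv; pose B c := \prod_(v | v != u) (if v \in c then r else 1 - r).
have bB c : bern r c = (if u \in c then r else 1 - r) * B c by rewrite /bern (bigD1 u).
pose Z := \sum_(c : {set N} | u \in c) B c * phi c.
have ZE : Z = \sum_(c : {set N} | u \notin c) B c * phi c.
  rewrite /Z (reindex_onto (fun c => u |: c) (fun c => c :\ u)) /=; last first.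
    by move=> c uc; rewrite setD1K.
  apply: eq_big => c.
    rewrite setU11 /=; apply/eqP/idP => [<-|uc]; first by rewrite !inE eqxx.
    by rewrite setU1K.
  move=> _; congr (_ * _).
    by apply: eq_bigr => v vu; rewrite !inE (negPf vu).
  by apply: inv => v vu; rewrite !inE (negPf vu).
have -> : \sum_c bern r c * ((u \in c)%:R * phi c) = r * Z.
  rewrite /Z mulr_sumr [RHS]big_mkcond; apply: eq_bigr => c _.
  by rewrite bB; case: ifP => _; rewrite ?mul0r ?mulr0 // mul1r mulrA.
congr (_ * _); rewrite (bigID (fun c => u \in c)) /=.
have -> : \sum_(c : {set N} | u \in c) bern r c * phi c = r * Z.
  by rewrite mulr_sumr; apply: eq_bigr => c uc; rewrite bB uc mulrA.
have -> : \sum_(c : {set N} | u \notin c) bern r c * phi c = (1 - r) * Z.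
  by rewrite ZE mulr_sumr; apply: eq_bigr => c uc; rewrite bB (negPf uc) mulrA.
ring.
Qed.

Lemma bern_mem r u : \sum_(c : {set N} | u \in c) bern r c = r.
Proof.
have /= := @sum_bern_in r u (fun=> 1) (fun _ _ _ => erefl).
rewrite -mulr_suml sum_bern !mulr1 => E; rewrite -[RHS]E big_mkcond /=.
by apply: eq_bigr => c _; case: (u \in c) => /=; ring.
Qed.

(* [L] is the sample; the elements of [c] are those that may be selected. *)
Definition Exp (r : R) (phi : {set N} -> {set N} -> R) : R :=
  \sum_L bern 2^-1 L * \sum_c bern r c * phi L c.

(** The term of [u] must not depend on the coins of [u] itself, so that these can be averaged out
    separately. *)
Definition predictable (phi : N -> {set N} -> {set N} -> R) :=
  forall u L L' c c', agree_off u L L' -> agree_off u c c' -> phi u L c = phi u L' c'.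

Lemma Exp_le r (phi psi : {set N} -> {set N} -> R) : 0 <= r <= 1 ->
  (forall L c, phi L c <= psi L c) -> Exp r phi <= Exp r psi.
Proof.
move=> r01 le; apply: ler_sum => L _; rewrite ler_wpM2l ?bern_ge0 //; first lra.
by apply: ler_sum => c _; rewrite ler_wpM2l ?bern_ge0.
Qed.

Lemma eq_Exp r phi psi : (forall L c, phi L c = psi L c) -> Exp r phi = Exp r psi.
Proof. by move=> E; apply: eq_bigr => L _; under eq_bigr do rewrite E. Qed.

Lemma ExpD r phi psi : Exp r (fun L c => phi L c + psi L c) = Exp r phi + Exp r psi.
Proof.
rewrite /Exp -big_split; apply: eq_bigr => L _ /=; rewrite -mulrDr -big_split /=.
by under eq_bigr do rewrite mulrDr.
Qed.

Lemma ExpZ r a phi : Exp r (fun L c => a * phi L c) = a * Exp r phi.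
Proof.
rewrite /Exp mulr_sumr; apply: eq_bigr => L _; rewrite mulrCA; congr (_ * _).
by rewrite mulr_sumr; apply: eq_bigr => c _; rewrite mulrCA.
Qed.

Lemma Exp_sum r (I : finType) (phi : I -> {set N} -> {set N} -> R) :
  Exp r (fun L c => \sum_i phi i L c) = \sum_i Exp r (phi i).
Proof.
rewrite /Exp [RHS]exchange_big; apply: eq_bigr => L _ /=; rewrite -mulr_sumr.
by rewrite [in RHS]exchange_big; under eq_bigr do rewrite mulr_sumr.
Qed.

Lemma Exp_sample r (phi : {set N} -> R) :
  Exp r (fun L _ => phi L) = \sum_L bern 2^-1 L * phi L.
Proof. by apply: eq_bigr => L _; rewrite -mulr_suml sum_bern mul1r. Qed.

Lemma Exp_cst r (a : R) : Exp r (fun _ _ => a) = a.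
Proof. by rewrite Exp_sample -mulr_suml sum_bern mul1r. Qed.

Lemma Exp_sample_at r u phi :
  (forall L L' c, agree_off u L L' -> phi L c = phi L' c) ->
  Exp r (fun L c => (u \in L)%:R * phi L c) = 2^-1 * Exp r phi.
Proof.
move=> inv; rewrite /Exp -(@sum_bern_in _ u) => [|L L' LL']; last first.
  by apply: eq_bigr => c _; rewrite (inv L L').
apply: eq_bigr => L _; congr (_ * _); rewrite mulr_sumr.
by apply: eq_bigr => c _; rewrite mulrCA.
Qed.

Lemma Exp_coin_at r u phi :
  (forall L c c', agree_off u c c' -> phi L c = phi L c') ->
  Exp r (fun L c => (u \in c)%:R * phi L c) = r * Exp r phi.
Proof.
move=> inv; rewrite /Exp mulr_sumr; apply: eq_bigr => L _; rewrite mulrCA.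
by congr (_ * _); rewrite sum_bern_in // => c c' /inv.
Qed.

(** Here and in the next two lemmas, the factor is the probability that [u] belongs to the random
    set, which is independent of a predictable term. *)
Lemma Exp_in_sample r phi : predictable phi ->
  Exp r (fun L c => \sum_u (u \in L)%:R * phi u L c) =
  2^-1 * Exp r (fun L c => \sum_u phi u L c).
Proof.
move=> pphi; rewrite !Exp_sum mulr_sumr; apply: eq_bigr => u _.
by apply: Exp_sample_at => L L' c LL'; apply: pphi.
Qed.

Lemma Exp_in_rest r phi : predictable phi ->
  Exp r (fun L c => \sum_u (u \in c :\: L)%:R * phi u L c) =
  r / 2 * Exp r (fun L c => \sum_u phi u L c).
Proof.
move=> pphi; rewrite !Exp_sum mulr_sumr; apply: eq_bigr => u _.
rewrite (@eq_Exp r _ (fun L c => (u \in c)%:R * ((u \notin L)%:R * phi u L c))); last first.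
  by move=> L c; rewrite inE mulrA -natrM mulnb andbC.
rewrite Exp_coin_at; last by move=> L c c' cc'; rewrite (pphi u L L c c').
rewrite (@eq_Exp r _ (fun L c => phi u L c + (-1) * ((u \in L)%:R * phi u L c))); last first.
  by move=> L c; case: (u \in L) => /=; ring.
rewrite ExpD ExpZ Exp_sample_at; last by move=> L L' c LL'; apply: pphi.
by field.
Qed.

Lemma Exp_in_either r phi : predictable phi ->
  Exp r (fun L c => \sum_u (u \in L :|: c)%:R * phi u L c) =
  (1 + r) / 2 * Exp r (fun L c => \sum_u phi u L c).
Proof.
move=> pphi; rewrite mulrDl mulrDl mul1r -Exp_in_sample // -Exp_in_rest // -ExpD.
apply: eq_Exp => L c; rewrite -big_split; apply: eq_bigr => u _ /=.
by rewrite -mulrDl -natrD !inE; do 2! case: (u \in _).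
Qed.

End Bernoulli.

(** * The greedy run and its prices *)

Section Greedy.
Variables (R : realType) (N : finType) (k : nat) (M : 'I_k -> matroid N).
Implicit Types (f g : {set N} -> R) (L U X Y Z S c I O Q G : {set N}) (u v : N).

Definition cindep I : bool := [forall i, M i I].

Definition marg f X u : R := f (u |: X) - f X.

Definition candidate f U X u : bool :=
  [&& u \in U, cindep (u |: X) & 0 < marg f X u].

(** Ties are broken by [pick], that is, by the fixed enumeration of [N], so that runs for different
    samples can be compared. *)
Definition best f U X : option N :=
  [pick u | candidate f U X u &&
            [forall v, candidate f U X v ==> (marg f X v <= marg f X u)]].

(* Greedy over the remaining elements [U], in which a picked element joins the
   solution [X] only if it belongs to [L]. Thus [X] evolves as in a greedy run on
   [L] alone, and [u \notin L] is listed iff greedy on [u |: L] would pick it. *)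
Fixpoint considered_from (n : nat) f L U X : seq N :=
  if n isn't n'.+1 then [::] else
  if best f U X isn't Some u then [::] else
  u :: considered_from n' f L (U :\ u) (if u \in L then u |: X else X).

(** Each step removes an element, so [#|N|] steps exhaust the candidates; see [best_end]. *)
Definition considered f L : seq N := considered_from #|N| f L setT set0.

Definition before f L u : {set N} :=
  [set v in take (index u (considered f L)) (considered f L)].

Definition weight f L u : R := marg f (L :&: before f L u) u.

Lemma cindepP I : reflect (common_indep M I) (cindep I).
Proof. exact: forallP. Qed.

Lemma cindep_sub I Y : I \subset Y -> cindep Y -> cindep I.
Proof. by move=> sIY /forallP H; apply/forallP=> i; apply: indep_sub sIY (H i). Qed.

Lemma marg_anti f X Y u : submodular f -> X \subset Y -> u \notin Y ->
  marg f Y u <= marg f X u.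
Proof.
move=> sf sXY uY; rewrite /marg.
have := sf (u |: X) Y.
rewrite -setUA (setUidPr sXY).
have -> : (u |: X) :&: Y = X.
  apply/setP=> v; rewrite !inE; case: eqP => [->|_] /=.
    by rewrite (negPf uY); apply/esym/negbTE; apply: contra uY; apply: (subsetP sXY).
  by apply/andP/idP => [[]//|vX]; split=> //; apply: (subsetP sXY).
by lra.
Qed.

Lemma bestP f U X u : best f U X = Some u ->
  candidate f U X u /\
  forall v, candidate f U X v -> marg f X v <= marg f X u.
Proof.
rewrite /best; case: pickP => // x /andP[cx /forallP mx] [<-]; split=> // v cv.
by move: (mx v); rewrite cv.
Qed.

Lemma best_None f U X v : best f U X = None -> ~~ candidate f U X v.
Proof.
rewrite /best; case: pickP => // noP _; apply/negP => cv.
case: (arg_maxP (marg f X) cv) => x cx mx.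
have := noP x; rewrite cx /= => /negP; apply; apply/forallP => y.
by apply/implyP => cy; apply: mx.
Qed.

(** The first element of the enumeration satisfying [P] is still the first one satisfying a stronger
    predicate, provided it satisfies it. *)
Lemma pick_sub (T : finType) (P Q : pred T) x : [pick y | P y] = Some x ->
  subpred Q P -> Q x -> [pick y | Q y] = Some x.
Proof.
rewrite /pick => Px QP Qx.
have -> : enum (fun y => Q y) = filter Q (enum (fun y => P y)).
  rewrite /enum_mem -filter_predI; apply: eq_filter => y /=.
  by rewrite /in_mem /=; case Qy: (Q y) => //=; rewrite QP.
move: Px; case: (enum _) => //= y s [->] /=.
by rewrite Qx.
Qed.

Lemma best_sub f g U U' X x : best f U X = Some x ->
  (forall v, candidate g U' X v -> candidate f U X v /\ marg g X v = marg f X v) ->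
  candidate g U' X x -> best g U' X = Some x.
Proof.
move=> bx gf cx; have [cfx mx] := bestP bx.
apply: pick_sub bx _ _.
  move=> v /andP[cv /forallP mv]; have [cfv ev] := gf v cv.
  rewrite cfv /=; apply/forallP => y; apply/implyP => cy.
  apply: le_trans (mx y cy) _.
  have := mv x; rewrite cx ev /= .
  by have [_ ->] := gf x cx.
rewrite cx; apply/forallP => v; apply/implyP => cv.
have [cfv ->] := gf v cv; have [_ ->] := gf x cx; exact: mx.
Qed.

Lemma considered_from_cat n f L U X t1 t2 :
  considered_from n f L U X = t1 ++ t2 ->
  t2 = considered_from (n - size t1) f L (U :\: [set x in t1])
         (X :|: (L :&: [set x in t1])).
Proof.
elim: t1 n U X => [|x t1 IH] [|n] U X //=.
- move=> <-.
  have -> : [set x in [::]] = set0 :> {set N} by apply/setP=> x; rewrite !inE.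
  by rewrite setI0 setU0 setD0.
- case E: best => [u|//] [<-{x E} /IH->]; rewrite subSS; congr considered_from.
    by apply/setP => v; rewrite !inE negb_or; case: (v == u); rewrite ?andbF.
  case: ifP => uL; apply/setP => v; rewrite !inE; case: (eqVneq v u) => [->|] //=.
    by rewrite uL !orbT.
  by rewrite uL.
Qed.

Lemma best_step f L t1 u t2 : considered f L = t1 ++ u :: t2 ->
  best f (~: [set x in t1]) (L :&: [set x in t1]) = Some u.
Proof.
move/considered_from_cat; rewrite setTD set0U.
by case: (_ - _)%N => //= n; case: best => // v [<-].
Qed.

Lemma considered_from_uniq n f L U X :
  uniq (considered_from n f L U X) /\ {subset considered_from n f L U X <= U}.
Proof.
elim: n U X => [|n IH] U X //=; case E: best => [u|//] /=.
have [/andP[uU _] _] := bestP E.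
have [IH1 IH2] := IH (U :\ u) (if u \in L then u |: X else X).
rewrite IH1 andbT; split.
  by apply/negP => /IH2; rewrite !inE eqxx.
by move=> v; rewrite inE => /orP[/eqP->//|/IH2]; rewrite !inE => /andP[].
Qed.

Lemma considered_uniq f L : uniq (considered f L).
Proof. by case: (considered_from_uniq #|N| f L setT set0). Qed.

Lemma best_end f L :
  best f (~: [set x in considered f L]) (L :&: [set x in considered f L]) = None.
Proof.
set t := considered f L.
have := @considered_from_cat #|N| f L setT set0 t [::].
rewrite cats0 => /(_ erefl); rewrite setTD set0U.
(* Either fuel is left and the run stopped because [best] found nothing, or [#|N|] distinct elements
   were listed and nothing remains. *)
case E: (_ - _)%N => [|n] /=; last by case: best.
move=> _; have := card_uniqP (considered_uniq f L); rewrite -/t => ct.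
have st : size t = #|N|.
  by apply/eqP; rewrite eqn_leq -{1}ct max_card /= -subn_eq0 E.
have tT : [set x in t] = setT.
  by apply/eqP; rewrite eqEcard subsetT cardsT -st -ct cardsE /=.
rewrite /best; case: pickP => // v; rewrite tT setCT.
by rewrite /candidate inE.
Qed.

Lemma considered_split f L u : u \in considered f L ->
  exists t2, considered f L =
    take (index u (considered f L)) (considered f L) ++ u :: t2.
Proof.
move=> ut; exists (drop (index u (considered f L)).+1 (considered f L)).
by rewrite -{1}(cat_take_drop (index u (considered f L)) (considered f L))
   (drop_nth u) ?index_mem // nth_index.
Qed.

Lemma best_before f L u : u \in considered f L ->
  best f (~: before f L u) (L :&: before f L u) = Some u.
Proof. by move=> /considered_split[t2 /best_step]. Qed.

Lemma in_before f L u v : u \in considered f L ->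
  (v \in before f L u) =
  (v \in considered f L) && (index v (considered f L) < index u (considered f L))%N.
Proof.
move=> ut; rewrite inE; set t := considered f L.
case vt : (v \in t) => /=; first by rewrite in_take.
by apply: contraFF vt; apply: mem_take.
Qed.

Lemma before_sub f L u : before f L u \subset [set x in considered f L].
Proof. by apply/subsetP => v; rewrite !inE; apply: mem_take. Qed.

Lemma notin_before f L u : u \notin before f L u.
Proof.
case ut : (u \in considered f L); first by rewrite in_before // ltnn andbF.
by apply: contraFN ut => /(subsetP (before_sub f L u)); rewrite inE.
Qed.

Lemma before_lt f L u v : u \in considered f L -> v \in before f L u ->
  before f L v \subset before f L u.
Proof.
move=> ut; rewrite in_before // => /andP[vt lt]; apply/subsetP => x.
by rewrite !in_before // => /andP[-> /=] /ltn_trans; apply.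
Qed.

Lemma weight_gt0 f L u : u \in considered f L -> 0 < weight f L u.
Proof. by move/best_before/bestP => [/and3P[]]. Qed.

Lemma cindep_before f L u : u \in considered f L ->
  cindep (u |: (L :&: before f L u)).
Proof. by move/best_before/bestP => [/and3P[]]. Qed.

(** When [v] was chosen, [u] was also a candidate: the solution was smaller, so independence held
    and, by submodularity, its marginal was at least its later price. Yet [v] was preferred. *)
Lemma weight_mono f L u v : submodular f -> u \in considered f L ->
  v \in before f L u -> weight f L u <= weight f L v.
Proof.
move=> sf ut vu; have sub := before_lt ut vu.
have vt : v \in considered f L by move: vu; rewrite in_before // => /andP[].
have sLI : L :&: before f L v \subset L :&: before f L u by apply: setIS.
have uv : u \notin before f L v by apply: contra (notin_before f L u); apply: (subsetP sub).
have le : weight f L u <= marg f (L :&: before f L v) u.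
  by apply: marg_anti => //; rewrite inE negb_and (notin_before f L u) orbT.
have [_ mv] := bestP (best_before vt).
apply: (le_trans le) (mv u _); rewrite /candidate inE uv /=.
rewrite (cindep_sub (setUS _ sLI) (cindep_before ut)) /=.
exact: lt_le_trans (weight_gt0 ut) le.
Qed.

(** The elements of [S] are added in the order of the run. [S] need not be the sample: it will also
    be [L :|: c] or a set of selectable elements. *)
Lemma telescope f S L : f (S :&: [set x in considered f L]) =
  f set0 + \sum_(u in [set x in considered f L] | u \in S) marg f (S :&: before f L u) u.
Proof.
rewrite /before; set t := considered f L; have: uniq t by apply: considered_uniq.
rewrite (eq_bigl (fun u => (u \in t) && (u \in S))); last by move=> u; rewrite inE.
move=> ut; rewrite big_mkcondr -big_uniq //=.
elim/last_ind: t ut => [_|t x IH].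
  rewrite big_nil addr0; congr f; apply/setP=> u; by rewrite !inE andbF.
rewrite rcons_uniq => /andP[xt ut]; rewrite -cats1 big_cat /= big_seq1.
have {}IH := IH ut; rewrite (eq_big_seq (fun u => if u \in S then
   marg f (S :&: [set v in take (index u t) t]) u else 0)); last first.
  move=> u utt; rewrite index_cat utt takel_cat // index_size //.
rewrite addrA -IH index_cat (negPf xt) /= eqxx addn0 take_size_cat //.
case: ifP => xS; last first.
  rewrite addr0; congr f; apply/setP => v; rewrite !inE mem_cat inE.
  by case: (eqVneq v x) => [->|]; rewrite ?xS ?orbF.
rewrite /marg subrKC; congr f; apply/setP => v; rewrite !inE mem_cat inE.
by case: (eqVneq v x) => [->|]; rewrite ?xS ?orbF ?orbT.
Qed.

(** Membership in the sample is consulted only after an element is listed, so the two runs coincide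
    until [u] is reached. *)
Lemma considered_from_toggle n f L L' U X u :
  (forall v, v != u -> (v \in L) = (v \in L')) ->
  let t := considered_from n f L U X in let t' := considered_from n f L' U X in
  (u \in t) = (u \in t') /\ take (index u t) t = take (index u t') t'.
Proof.
move=> LL' /=; elim: n U X => [|n IH] U X //=; case E: best => [x|] //=.
case: (eqVneq x u) => [->|xu]; first by rewrite !inE eqxx.
have -> : (x \in L) = (x \in L') by apply: LL'.
have [IH1 IH2] := IH (U :\ x) (if x \in L' then x |: X else X).
by rewrite !inE IH1 /= IH2.
Qed.

Lemma considered_toggle f L L' u : (forall v, v != u -> (v \in L) = (v \in L')) ->
  (u \in considered f L) = (u \in considered f L').
Proof. by move=> /(considered_from_toggle #|N| f setT set0)[]. Qed.

Lemma before_toggle f L L' u : (forall v, v != u -> (v \in L) = (v \in L')) ->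
  before f L u = before f L' u.
Proof. by rewrite /before => /(considered_from_toggle #|N| f setT set0)[_ ->]. Qed.

(* [g] makes the elements outside [S] worthless. The run for [f] may pick some of
   them, but as they are not in [L] this does not affect the later marginals. *)
Lemma considered_from_local n n' f g L S U U' X u :
  (forall Y, Y \subset S -> g Y = f Y) -> (forall Y, g Y = g (Y :&: S)) ->
  L \subset S -> X \subset S -> u \in S ->
  (#|U| <= n)%N -> (#|U' :&: S| <= n')%N -> U :&: S = U' :&: S ->
  let t := considered_from n f L U X in let t' := considered_from n' g L U' X in
  (u \in t) = (u \in t') /\
  L :&: [set x in take (index u t) t] = L :&: [set x in take (index u t') t'].
Proof.
move=> gf gS LS + uS; elim: n n' U U' X => [|n IH] n' U U' X XS; rewrite /=.
  rewrite leqn0 cards_eq0 => /eqP-> _; rewrite set0I => /esym U'S.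
  suff -> : considered_from n' g L U' X = [::] by [].
  case: n' => //= n'; case E: best => [x|//].
  have [/and3P[xU' _ mx] _] := bestP E.
  suff: x \in U' :&: S by rewrite U'S inE.
  rewrite inE xU' /=; apply: contraLR mx => xS; rewrite /marg [g (x |: _)]gS [g X]gS.
  suff -> : (x |: X) :&: S = X :&: S by rewrite subrr ltxx.
  by apply/setP => y; rewrite !inE; case: eqP => // ->; rewrite (negPf xS) !andbF.
move=> cU cU' UU'.
(* Outside [S] the marginals of [g] vanish, so every candidate for [g] lies in [S], where both
   functions agree. *)
have cand v : candidate g U' X v -> candidate f U X v /\ marg g X v = marg f X v.
  move=> /and3P[vU' vc vm].
  have vS : v \in S.
    apply: contraLR vm => xS; rewrite /marg [g (v |: _)]gS [g X]gS.
    suff -> : (v |: X) :&: S = X :&: S by rewrite subrr ltxx.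
    by apply/setP => y; rewrite !inE; case: eqP => // ->; rewrite (negPf xS) !andbF.
  have e : marg g X v = marg f X v.
    by rewrite /marg !gf // subUset sub1set vS.
  split=> //; rewrite /candidate vc -e vm !andbT.
  by have /setP/(_ v) := UU'; rewrite !inE vS vU' !andbT.
case E: best => [x|]; last first.
  suff -> : considered_from n' g L U' X = [::] by [].
  case: n' {cU'} => //= n'; case E': best => [x|//].
  have [/cand[cx _] _] := bestP E'.
  by have := best_None x E; rewrite cx.
have [/and3P[xU xc xm] _] := bestP E.
have cUx : (#|U :\ x| <= n)%N by move: cU; rewrite (cardsD1 x U) xU.
(* An element outside [S] is listed by the run for [f] only; it is not in [L], so [X] stays the same
   and the other run waits. *)
case xS : (x \in S); last first.
  have xL : x \in L = false by apply: contraFF xS; apply: (subsetP LS).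
  have xu : x != u by apply: contraFneq xS => ->.
  have e1 : (U :\ x) :&: S = U' :&: S.
    rewrite -UU'; apply/setP => y; rewrite !inE; case: eqP => // ->.
    by rewrite xS !andbF.
  have := IH n' (U :\ x) U' X XS cUx cU' e1 => /= -[IH1 IH2].
  rewrite xL inE eq_sym (negPf xu) /= IH1 -IH2; split=> //.
  apply/setP => y; rewrite !inE; case: eqP => // ->.
  by rewrite xL.
have xU' : x \in U' by have /setP/(_ x) := UU'; rewrite !inE xS xU !andbT => <-.
have cx : candidate g U' X x.
  rewrite /candidate xU' xc /= /marg !gf //.
  by rewrite subUset sub1set xS.
case: n' cU' => [|n'] cU'.
  by move: cU'; rewrite leqn0 cards_eq0 => /eqP/setP/(_ x); rewrite !inE xU' xS.
rewrite /= (best_sub E cand cx).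
have cU'x : (#|(U' :\ x) :&: S| <= n')%N.
  by move: cU'; rewrite (cardsD1 x) !inE xU' xS /= setIDAC.
have e1 : (U :\ x) :&: S = (U' :\ x) :&: S.
  by rewrite !(setIDAC _ [set x]) UU'.
have XS' : (if x \in L then x |: X else X) \subset S.
  by case: ifP => // _; rewrite subUset sub1set xS.
have := IH n' _ _ _ XS' cUx cU'x e1 => /= -[IH1 IH2].
rewrite !inE IH1; split=> //; case: (x == u) => //=.
by apply/setP => y; have /setP/(_ y) := IH2; rewrite !inE; case: (y == x).
Qed.

(** This is what the value oracle answers once exactly [S] has arrived. *)
Definition restrict f S : {set N} -> R := fun X => f (X :&: S).

Lemma restrict_sub f S Y : Y \subset S -> restrict f S Y = f Y.
Proof. by rewrite /restrict => /setIidPl->. Qed.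

Lemma restrictI f S Y : restrict f S Y = restrict f S (Y :&: S).
Proof. by rewrite /restrict -setIA setIid. Qed.

(** This makes the construction online: as soon as the sample and [u] have arrived, it can be
    decided whether greedy would pick [u], and by the next lemma at which price. *)
Lemma considered_restrict f L S u : L \subset S -> u \in S ->
  (u \in considered (restrict f S) L) = (u \in considered f L).
Proof.
move=> LS uS.
by have [->] := @considered_from_local #|N| #|N| f _ L S setT setT set0 u
  (@restrict_sub f S) (@restrictI f S) LS (sub0set _) uS (max_card _) (max_card _) erefl.
Qed.

Lemma weight_restrict f L S u : L \subset S -> u \in S ->
  weight (restrict f S) L u = weight f L u.
Proof.
move=> LS uS.
have [_ e] := @considered_from_local #|N| #|N| f _ L S setT setT set0 u
  (@restrict_sub f S) (@restrictI f S) LS (sub0set _) uS (max_card _) (max_card _) erefl.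
rewrite /weight /before -/(considered _ _) -/(considered _ _) in e *.
rewrite e /marg; set Z := L :&: _.
have ZS : Z \subset S by apply: subset_trans LS; apply: subsetIl.
by rewrite !restrict_sub // subUset sub1set uS.
Qed.

Lemma cindep0 : cindep set0.
Proof. by apply/forallP => i; apply: indep0. Qed.

(** Each [u] in [X] is blocked by some matroid. Those blocked by [M i] form an independent set of
    [M i] none of whose elements extends [Y], so by augmentation there are at most [#|Y|] of
    them. *)
Lemma card_blocked X Y Z : X \subset Z -> cindep Z -> cindep Y ->
  (forall u, u \in X -> ~~ cindep (u |: Y)) -> (#|X| <= k * #|Y|)%N.
Proof.
move=> XZ cZ cY bl; pose X_ i := [set u in X | ~~ M i (u |: Y)].
have leY i : (#|X_ i| <= #|Y|)%N.
  rewrite leqNgt; apply/negP => lt.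
  have iX : M i (X_ i).
    move/forallP: cZ => /(_ i); apply: indep_sub; apply: subset_trans XZ.
    by apply/subsetP => v; rewrite inE => /andP[].
  have [u] := indep_aug (forallP cY i) iX lt.
  by rewrite !inE => /and3P[_ _ /negP].
have le : (\sum_i #|X_ i| <= k * #|Y|)%N.
  have -> : (k * #|Y| = \sum_(i < k) #|Y|)%N by rewrite sum_nat_const card_ord.
  by apply: leq_sum => i _; apply: leY.
apply: leq_trans le.
rewrite -sum1_card; under [leqRHS]eq_bigr do rewrite -sum1_card big_mkcond.
rewrite exchange_big big_mkcond; apply: leq_sum => u _; case: ifP => // uX.
have /forallPn[i Mi] := bl u uX.
by rewrite (bigD1 i) //= inE uX Mi.
Qed.

Lemma cindep_considered f L : cindep (L :&: [set x in considered f L]).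
Proof.
suff H t1 t2 : considered f L = t1 ++ t2 -> cindep (L :&: [set x in t1]).
  by apply: (H _ [::]); rewrite cats0.
elim/last_ind: t1 t2 => [|t1 x IH] t2 E.
  by apply: cindep_sub cindep0; apply/subsetP => v; rewrite !inE andbF.
rewrite cat_rcons in E; have [/and3P[_ ci _] _] := bestP (best_step E).
case xL : (x \in L).
  apply: cindep_sub ci; apply/subsetP => v.
  by rewrite !inE mem_rcons inE; case: (v == x); rewrite ?orbT.
apply: cindep_sub (IH _ E); apply/subsetP => v.
by rewrite !inE mem_rcons inE; case: eqP => //= ->; rewrite xL.
Qed.

Lemma submodular_union_le f X Y : submodular f -> [disjoint X & Y] ->
  f (X :|: Y) <= f X + \sum_(u in Y) marg f X u.
Proof.
move=> sf; have [n] := ubnP #|Y|; elim: n Y => // n IH Y cY XY.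
have [->|[x xY]] := set_0Vmem Y; first by rewrite setU0 big_set0 addr0.
have XY' : [disjoint X & Y :\ x] by apply: disjointWr XY; apply: subD1set.
have cY' : (#|Y :\ x| < n)%N by move: cY; rewrite (cardsD1 x) xY.
have := IH _ cY' XY'; rewrite (big_setD1 x xY) /=.
have xXY : x \notin X :|: (Y :\ x).
  by rewrite !inE eqxx orbF; apply/negP => xX; move/disjointFr: XY => /(_ _ xX); rewrite xY.
have := marg_anti sf (subsetUl X (Y :\ x)) xXY.
rewrite {1}/marg; have -> : x |: (X :|: (Y :\ x)) = X :|: Y.
  by rewrite setUCA setD1K.
lra.
Qed.

Lemma weight_sample f L : f (L :&: [set x in considered f L]) =
  f set0 + \sum_(u in L :&: [set x in considered f L]) weight f L u.
Proof.
rewrite telescope; congr (_ + _); rewrite /weight.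
by apply: eq_bigl => u; rewrite [in RHS]inE andbC.
Qed.

(** The elements of [O] outside the greedy solution [G] are of three kinds. Those in the run but not
    in [L] add at most their price; those never listed and blocked by [G] are charged to the prices
    in [G]; those never listed and not blocked have marginal at most 0, as otherwise the run would
    continue. *)
Lemma opt_le f L O : submodular f -> (forall X, 0 <= f X) -> cindep O ->
  f (O :|: (L :&: [set x in considered f L])) <=
  f (L :&: [set x in considered f L])
    + \sum_(u in [set x in considered f L] :\: L) weight f L u
    + k%:R * (f (L :&: [set x in considered f L]) - f set0).
Proof.
move=> sf f0 cO; set D := [set x in considered f L]; set G := L :&: D.
pose Y := O :\: G; pose X := [set u in O :\: D | ~~ cindep (u |: G)].
have UY : O :|: G = G :|: Y by apply/setP => v; rewrite !in_setU in_setD; case: (v \in G); rewrite ?orbT ?orbF.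
have dGY : [disjoint G & Y].
  by rewrite -setI_eq0; apply/eqP/setP => v; rewrite !inE; case: (v \in L); case: (v \in considered f L); rewrite ?andbF.
have wD u : u \in D -> 0 < weight f L u by rewrite inE => /weight_gt0.
have leX : \sum_(u in X) marg f G u <= k%:R * \sum_(u in G) weight f L u.
  apply: layer_cake_le => [u|theta theta0].
    by rewrite inE => /andP[_ /wD /ltW].
  set G' := [set y in G | (theta <= weight f L y)%R].
  apply: (@card_blocked _ G' O) => //.
  - by apply/subsetP => u; rewrite !inE => /andP[/andP[/andP[]]].
  - apply: cindep_sub (cindep_considered f L).
    by apply/subsetP => u; rewrite inE => /andP[].
  move=> u; rewrite 3!inE -andbA => /andP[/andP[uD uO] /andP[bl mu]].
  apply: contra bl => ci.
  have [->//|GG'] := eqVneq G G'.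
  have [v vG vw] : exists2 v, v \in G & weight f L v < theta.
    have /subsetPn[v vG] : ~~ (G \subset G').
      apply: contra GG' => GG'; rewrite eqEsubset GG' /=.
      by apply/subsetP => v; rewrite inE => /andP[].
    by rewrite inE vG -ltNge; exists v.
  pose P := [pred x | (x \in G) && (weight f L x < theta)].
  have Pv : P v by rewrite /= vG.
  (* Take the first [z] of [G] cheaper than [theta]. The solution at that moment lies in [G'], so
     [u] was a candidate with marginal at least [theta], and [z] would not have been chosen. *)
  have [z /= /andP[zG zw] zmin] :=
    arg_minnP (fun x => index x (considered f L)) Pv.
  have zD : z \in considered f L by move: zG; rewrite !inE => /andP[].
  have sub : L :&: before f L z \subset G'.
    apply/subsetP => y; rewrite inE => /andP[yL]; rewrite in_before // => /andP[yD lt].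
    have yG : y \in G by rewrite !inE yL.
    rewrite inE yG /= leNgt; apply/negP => yw.
    by have := zmin y; rewrite yG yw /= => /(_ isT); rewrite leqNgt lt.
  have subG : L :&: before f L z \subset G by apply: setIS; apply: before_sub.
  have uG : u \notin G by rewrite !inE negb_and; move: uD; rewrite inE => ->; rewrite orbT.
  have le := marg_anti sf subG uG.
  have [_ /(_ u)] := bestP (best_before zD).
  rewrite /candidate inE (cindep_sub (setUS _ sub) ci).
  have -> /= : u \notin before f L z.
    by apply: contra uD; apply: (subsetP (before_sub f L z)).
  have lt0 : 0 < marg f (L :&: before f L z) u.
    by apply: lt_le_trans le; apply: lt_le_trans mu.
  move=> /(_ lt0) le'.
  have : theta <= weight f L z by apply: le_trans le'; apply: le_trans le.
  by rewrite leNgt zw.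
have leD : \sum_(u in Y | u \in D) marg f G u <= \sum_(u in D :\: L) weight f L u.
  rewrite big_mkcondl [leRHS]big_mkcond [leLHS]big_mkcond /=; apply: ler_sum => u _.
  rewrite !inE; case uD : (u \in considered f L); last by rewrite andbF.
  have wu : 0 <= weight f L u by apply/ltW/weight_gt0.
  rewrite andbT; case uL : (u \in L) => //=.
  case: ifP => // uO; apply: marg_anti => //.
    by apply: setIS; apply: before_sub.
  by rewrite inE uL.
have leND : \sum_(u in Y | u \notin D) marg f G u <= \sum_(u in X) marg f G u.
  rewrite [leRHS]big_mkcond [leLHS]big_mkcond /=; apply: ler_sum => u _.
  rewrite !inE; case uD : (u \in considered f L) => /=; first by rewrite andbF.
  rewrite !andbF andbT /=; case uO : (u \in O) => //=.
  case ci : (cindep (u |: G)) => //=.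
  have := @best_None f _ _ u (best_end f L).
  by rewrite /candidate !inE uD ci /= -leNgt.
have := submodular_union_le sf dGY; rewrite -UY (bigID (fun u => u \in D)) /=.
have := weight_sample f L; rewrite -/G -/D => ->.
set a := \sum_(u in G) _ in leX *.
by rewrite [f set0 + a - _]addrC addKr; lra.
Qed.

(** * First-fit and the loss of linearization *)

(** Used only in the analysis, as an independent set bounding the linear optimum from below. *)
Definition firstfit S (t : seq N) : {set N} :=
  foldl (fun I u => if (u \in S) && cindep (u |: I) then u |: I else I) set0 t.

Lemma firstfit_rcons S t x : firstfit S (rcons t x) =
  if (x \in S) && cindep (x |: firstfit S t) then x |: firstfit S t else firstfit S t.
Proof. by rewrite /firstfit -cats1 foldl_cat. Qed.

Lemma firstfit_cindep S t : cindep (firstfit S t).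
Proof.
elim/last_ind: t => [|t x IH]; first exact: cindep0.
by rewrite firstfit_rcons; case: ifP => // /andP[].
Qed.

Lemma firstfit_in S t u : u \in firstfit S t -> (u \in S) && (u \in t).
Proof.
elim/last_ind: t => [|t x IH]; first by rewrite inE.
rewrite firstfit_rcons mem_rcons inE; case: ifP => [/andP[xS _]|_].
  by rewrite !inE; case: eqP => [->|_ /IH]; rewrite ?xS.
by move=> /IH /andP[-> ->]; rewrite orbT.
Qed.

Lemma firstfit_take S t i : firstfit S (take i t) \subset firstfit S t.
Proof.
rewrite -{2}(cat_take_drop i t); elim/last_ind: (drop i t) => [|s x IH].
  by rewrite cats0.
rewrite -rcons_cat firstfit_rcons; case: ifP => // _.
by apply: subset_trans IH (subsetUr _ _).
Qed.

Lemma mem_firstfit S t u : uniq t -> u \in t ->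
  (u \in firstfit S t) =
  (u \in S) && cindep (u |: firstfit S (take (index u t) t)).
Proof.
elim/last_ind: t => [|t x IH] //; rewrite rcons_uniq => /andP[xt ut].
have nxt : x \notin firstfit S t by apply: contra xt => /firstfit_in/andP[].
rewrite firstfit_rcons mem_rcons inE -cats1 index_cat.
case: (eqVneq u x) => [-> _|ux /= u_t].
  rewrite (negPf xt) /= eqxx addn0 take_size_cat //.
  by case: ifP => [|_]; rewrite ?setU11 // (negPf nxt).
rewrite u_t takel_cat ?index_size // -IH //.
by case: ifP => // _; rewrite !inE (negPf ux).
Qed.

Lemma eq_firstfit S S' t : {in t, S =i S'} -> firstfit S t = firstfit S' t.
Proof.
elim/last_ind: t => [|t x IH] E //; rewrite !firstfit_rcons IH ?E //.
  by rewrite mem_rcons mem_head.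
by move=> v vt; apply: E; rewrite mem_rcons inE vt orbT.
Qed.

(** Meaningful for every [u], selectable or not, and independent of its coins, so blocked prices can
    be compared between the sample and the rest. *)
Definition blocked f L c u : bool :=
  ~~ cindep (u |: firstfit (c :\: L) (take (index u (considered f L)) (considered f L))).

(** Prices decrease along the run, so whatever blocks [u] costs at least as much as [u]. At every
    price level, [card_blocked] charges the blocked part of the greedy solution to first-fit. *)
Lemma blocked_le f L c : submodular f ->
  \sum_(u in L :&: [set x in considered f L] | blocked f L c u) weight f L u <=
  k%:R * \sum_(u in firstfit (c :\: L) (considered f L)) weight f L u.
Proof.
move=> sf; set I := firstfit _ _; set G := L :&: _.
rewrite (eq_bigl (fun u => u \in [set u in G | blocked f L c u])); last first.
  by move=> u; rewrite [in RHS]inE.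
have ID u : u \in I -> u \in considered f L by move=> /firstfit_in/andP[].
apply: layer_cake_le => [u /ID/weight_gt0/ltW //|theta theta0].
apply: (@card_blocked _ _ G).
- by apply/subsetP => u; rewrite inE => /andP[]; rewrite inE => /andP[].
- exact: cindep_considered.
- apply: cindep_sub (firstfit_cindep (c :\: L) (considered f L)).
  by apply/subsetP => u; rewrite inE => /andP[].
move=> u; rewrite inE => /andP[]; rewrite inE => /andP[uG bl] wu.
apply: contra bl; apply: cindep_sub; apply: setUS.
apply/subsetP => v vI; rewrite inE.
rewrite (subsetP (firstfit_take _ _ _) _ vI) /=; apply: le_trans wu _.
have uD : u \in considered f L by move: uG; rewrite !inE => /andP[].
by apply: weight_mono => //; rewrite inE; case/firstfit_in/andP: vI.
Qed.

(* [gain] is what [u] adds to everything that preceded it in the sample or among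
   the selectable elements; by submodularity, [weight - gain] bounds what is lost
   by treating [f] as if it were the linear function [weight]. *)
Definition gain f L c u : R := marg f ((L :|: c) :&: before f L u) u.

Definition selectable f L c : {set N} := (c :\: L) :&: [set x in considered f L].

Definition loss f L c : R :=
  \sum_(u in selectable f L c) (weight f L u - gain f L c u).

Lemma gain_le f L c u : submodular f -> gain f L c u <= weight f L u.
Proof.
move=> sf; apply: marg_anti => //; first by apply: setSI; apply: subsetUl.
by rewrite inE (negPf (notin_before f L u)) andbF.
Qed.

(** The elements of [Q] before [u] belong to [L :|: c], so [u] adds at least its [gain]. The terms
    of [loss] outside [Q] are nonnegative; including them makes the bound on the loss independent of
    the choice of [Q]. *)
Lemma value_ge f L c Q : submodular f -> Q \subset selectable f L c ->
  f set0 + \sum_(u in Q) weight f L u <= f Q + loss f L c.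
Proof.
move=> sf QN.
have QD : Q :&: [set x in considered f L] = Q.
  by apply/setIidPl; apply: subset_trans QN (subsetIr _ _).
rewrite -[in f Q]QD telescope -addrA lerD2l.
rewrite /loss [X in _ <= _ + X](big_setID Q) /= (setIidPr QN).
have H : \sum_(u in Q) gain f L c u <=
    \sum_(u in [set x in considered f L] | u \in Q) marg f (Q :&: before f L u) u.
  rewrite [leRHS](eq_bigl (fun u => u \in Q)); last first.
    by move=> u; rewrite -in_setI setIC QD.
  apply: ler_sum => u uQ; apply: marg_anti => //; last first.
    by rewrite inE (negPf (notin_before f L u)) andbF.
  apply: setSI; apply: subset_trans QN _; apply/subsetP => v.
  by rewrite !inE => /andP[/andP[_ ->]]; rewrite orbT.
have : 0 <= \sum_(u in selectable f L c :\: Q) (weight f L u - gain f L c u).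
  by apply: sumr_ge0 => u _; rewrite subr_ge0 gain_le.
have -> : \sum_(u in Q) (weight f L u - gain f L c u) =
    \sum_(u in Q) weight f L u - \sum_(u in Q) gain f L c u by rewrite -sumrB.
by lra.
Qed.

Lemma value_either f L c : f ((L :|: c) :&: [set x in considered f L]) =
  f set0 + \sum_(u in [set x in considered f L] | u \in L :|: c) gain f L c u.
Proof. exact: telescope. Qed.

(** * Invariance under toggling the coins of one element *)

Lemma sum_indicator (A : {set N}) (F : N -> R) :
  \sum_(u in A) F u = \sum_u (u \in A)%:R * F u.
Proof. by rewrite big_mkcond; apply: eq_bigr => u _; case: ifP; rewrite ?mul1r ?mul0r. Qed.

Definition fresh_weight f u L : R := (u \in considered f L)%:R * weight f L u.

Lemma setI_before_toggle f L L' S S' u : agree_off u L L' -> agree_off u S S' ->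
  S :&: before f L u = S' :&: before f L' u.
Proof.
move=> LL' SS'; rewrite -(before_toggle f LL'); apply/setP => v; rewrite !inE.
case: (eqVneq v u) => [->|/SS'-> //].
by have := notin_before f L u; rewrite inE => /negPf->; rewrite !andbF.
Qed.

Lemma fresh_weight_toggle f L L' u : agree_off u L L' ->
  fresh_weight f u L = fresh_weight f u L'.
Proof.
move=> LL'; rewrite /fresh_weight /weight (considered_toggle f LL').
by rewrite (setI_before_toggle f LL' LL').
Qed.

Lemma gain_toggle f L L' c c' u : agree_off u L L' -> agree_off u c c' ->
  gain f L c u = gain f L' c' u.
Proof.
move=> LL' cc'; rewrite /gain.
by rewrite (setI_before_toggle f LL' (S' := L' :|: c')) // => v vu; rewrite !inE LL' ?cc'.
Qed.

Lemma blocked_toggle f L L' c c' u : agree_off u L L' -> agree_off u c c' ->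
  blocked f L c u = blocked f L' c' u.
Proof.
move=> LL' cc'; rewrite /blocked.
have [_ E] := considered_from_toggle #|N| f setT set0 LL'.
rewrite [take _ _]E; congr (~~ cindep (_ |: _)); apply: eq_firstfit => v vt.
have vu : v != u.
  apply: contraTneq vt => ->.
  by have := notin_before f L' u; rewrite /before inE.
by rewrite !inE LL' ?cc'.
Qed.

(** * Expected prices, gains and losses *)

Section Expectations.
Variables (f : {set N} -> R) (r : R) (O : {set N}).
Hypotheses (sf : submodular f) (f0 : forall X, 0 <= f X) (r01 : 0 <= r <= 1).
Hypothesis (cO : cindep O).

Let D L := [set x in considered f L].
Let W := Exp r (fun L _ => \sum_u fresh_weight f u L).
Let Wb := Exp r (fun L c => \sum_u (blocked f L c u)%:R * fresh_weight f u L).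
Let T := Exp r (fun L c => \sum_u (u \in considered f L)%:R * gain f L c u).
Let EI := Exp r (fun L c =>
  \sum_(u in firstfit (c :\: L) (considered f L)) weight f L u).

Let sum_D (A : {set N}) L c (F : N -> R) :
  \sum_(u in A :&: D L) F u = \sum_u (u \in A)%:R * ((u \in considered f L)%:R * F u).
Proof.
rewrite sum_indicator; apply: eq_bigr => u _.
by rewrite !inE mulrA -natrM mulnb.
Qed.

Let fresh_ge0 u L : 0 <= fresh_weight f u L.
Proof.
rewrite /fresh_weight; case uD : (u \in _); last by rewrite mul0r.
by rewrite mul1r ltW // weight_gt0.
Qed.

Let W_ge0 : 0 <= W.
Proof.
rewrite -(Exp_cst N r 0); apply: Exp_le => // L c.
by apply: sumr_ge0 => u _; apply: fresh_ge0.
Qed.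

Let pred_fresh : predictable (fun u L _ => fresh_weight f u L).
Proof. by move=> u L L' c c' LL' _; apply: fresh_weight_toggle. Qed.

Let pred_blocked : predictable (fun u L c => (blocked f L c u)%:R * fresh_weight f u L).
Proof.
move=> u L L' c c' LL' cc'.
by rewrite (blocked_toggle f LL' cc') (fresh_weight_toggle f LL').
Qed.

Let pred_gain : predictable (fun u L c => (u \in considered f L)%:R * gain f L c u).
Proof.
by move=> u L L' c c' LL' cc'; rewrite (gain_toggle f LL' cc') (considered_toggle f LL').
Qed.

Let E_sample : Exp r (fun L _ => f (L :&: D L)) = f set0 + 2^-1 * W.
Proof.
rewrite -(Exp_in_sample r pred_fresh) -[f set0 in RHS](Exp_cst N r) -ExpD.
by apply: eq_Exp => L c; rewrite weight_sample sum_D.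
Qed.

Let E_blocked : 2^-1 * Wb <= k%:R * EI.
Proof.
rewrite -(Exp_in_sample r pred_blocked) -ExpZ; apply: Exp_le => // L c.
apply: le_trans (blocked_le L c sf); rewrite big_mkcondr /= sum_D //.
apply: ler_sum => u _; rewrite le_eqVlt; apply/orP; left; apply/eqP; congr (_ * _).
by rewrite /fresh_weight; case: (blocked _ _ _ _); rewrite ?mul1r ?mul0r ?mulr0.
Qed.

(** First-fit keeps exactly the selectable elements that are not blocked. *)
Let E_firstfit : EI = r / 2 * (W - Wb).
Proof.
rewrite mulrBr -(Exp_in_rest r pred_fresh) -(Exp_in_rest r pred_blocked).
rewrite -mulN1r -ExpZ -ExpD; apply: eq_Exp => L c.
rewrite mulN1r -sumrB sum_indicator; apply: eq_bigr => u _.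
rewrite -mulrBr /fresh_weight; case uD : (u \in considered f L); last first.
  rewrite !mul0r mulr0 subrr mulr0.
  case uI : (u \in firstfit _ _); last by rewrite mul0r.
  by move/firstfit_in: uI => /andP[_]; rewrite uD.
rewrite mem_firstfit ?considered_uniq // /blocked.
by case: (u \in c :\: L); case: (cindep _) => /=; ring.
Qed.

Let E_loss : Exp r (fun L c => loss f L c) = r / 2 * (W - T).
Proof.
rewrite mulrBr -(Exp_in_rest r pred_fresh) -(Exp_in_rest r pred_gain).
rewrite -mulN1r -ExpZ -ExpD; apply: eq_Exp => L c.
rewrite mulN1r -sumrB /loss sum_D //; apply: eq_bigr => u _.
by rewrite /fresh_weight -mulrBr -mulrBr.
Qed.

Let E_either : Exp r (fun L c => f ((L :|: c) :&: D L)) = f set0 + (1 + r) / 2 * T.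
Proof.
rewrite -(Exp_in_either r pred_gain) -[f set0 in RHS](Exp_cst N r) -ExpD.
apply: eq_Exp => L c; rewrite value_either -sum_D //; congr (_ + _).
by apply: eq_bigl => u; rewrite in_setI andbC.
Qed.

(** For a fixed sample, the sampling lemma applies to [X |-> f (L :&: D L :|: X)]: each coin
    succeeds with probability [r], so at least a fraction [1 - r] of the greedy value survives. *)
Let E_either_ge : (1 - r) * Exp r (fun L _ => f (L :&: D L)) <=
  Exp r (fun L c => f ((L :|: c) :&: D L)).
Proof.
rewrite -ExpZ /Exp; apply: ler_sum => L _; rewrite ler_wpM2l ?bern_ge0 //; first lra.
rewrite -mulr_suml sum_bern mul1r.
have /andP[r0 r1] := r01.
pose g X := f ((L :&: D L) :|: X).
have gE : g set0 = f (L :&: D L) by rewrite /g setU0.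
have := @sampling_ge R _ N (bern r) id g r 0 (D L) (fun c => bern_ge0 c r01)
  (sum_bern N r) (fun X => f0 _).
rewrite mul0r addr0 gE => H; apply: le_trans (H _ _ r0) _.
- by move=> X Y; rewrite /g setUUr setUIr; apply: sf.
- by move=> u _; rewrite bern_mem r0 lexx.
apply: ler_sum => c _; rewrite ler_wpM2l ?bern_ge0 //.
rewrite le_eqVlt; apply/orP; left; apply/eqP; congr f.
by rewrite setIUl.
Qed.

(** The greedy solution is contained in [L], so each element is in it with probability at most 1/2;
    the sampling lemma does not ask for independence. *)
Let E_opt : 2^-1 * f O <= Exp r (fun L _ => f (O :|: (L :&: D L))).
Proof.
rewrite Exp_sample; pose g X := f (O :|: X).
have gE : g set0 = f O by rewrite /g setU0.
have := @sampling_ge R _ N (bern 2^-1) (fun L => L :&: D L) g 2^-1 0 setT.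
rewrite mul0r addr0 gE => H.
have -> : 2^-1 * f O = (1 - 2^-1) * f O by congr (_ * _); field.
have half : 0 <= (2^-1 : R) <= 1 by lra.
have := H (fun c => bern_ge0 c half) (sum_bern N _) (fun X => f0 _).
move=> {}H; apply: le_trans (H _ _ _) _; last 1 first.
- by apply: ler_sum => L _; rewrite setIT.
- by move=> X Y; rewrite /g setUUr setUIr; apply: sf.
- move=> u _; apply/andP; split; first by apply: sumr_ge0 => c _; apply: bern_ge0.
  rewrite -[leRHS](bern_mem 2^-1 u) big_mkcond [leRHS]big_mkcond /=.
  apply: ler_sum => c _; rewrite inE; case: (u \in c) => //=.
  by case: ifP => // _; apply: bern_ge0.
- lra.
Qed.

Let E_opt_le : Exp r (fun L _ => f (O :|: (L :&: D L))) <=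
  f set0 + W + k%:R * (2^-1 * W).
Proof.
have E_rest : Exp r (fun L _ => \sum_(u in D L :\: L) weight f L u) = 2^-1 * W.
  have -> : 2^-1 * W = W + (-1) * (2^-1 * W) by field.
  rewrite -(Exp_in_sample r pred_fresh) -ExpZ -ExpD; apply: eq_Exp => L c.
  rewrite mulN1r -sumrB sum_indicator; apply: eq_bigr => u _.
  by rewrite /fresh_weight !inE; do 2! case: (u \in _) => /=; ring.
have -> : f set0 + W + k%:R * (2^-1 * W) =
    Exp r (fun L _ => f (L :&: D L) + \sum_(u in D L :\: L) weight f L u
      + k%:R * (f (L :&: D L) + (-1) * f set0)).
  by rewrite !ExpD ExpZ ExpD E_sample E_rest ExpZ Exp_cst; field.
apply: Exp_le => // L c; rewrite mulN1r; exact: opt_le.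
Qed.

Lemma Exp_value_ge (alpha : R) : (0 < k)%N -> 0 <= alpha <= 1 ->
  r = alpha / (4 * k%:R) ->
  alpha ^+ 2 / (128 * k%:R ^+ 2) * f O <=
  Exp r (fun L c => f set0 - loss f L c + alpha *
    \sum_(u in firstfit (c :\: L) (considered f L)) weight f L u).
Proof.
move=> k0 /andP[a0 a1] rE; set K : R := k%:R.
have K1 : 1 <= K by rewrite ler1n.
have rK : r * K = alpha / 4 by rewrite rE /K; field; lra.
have ra : r <= alpha / 4.
  by rewrite -rK ler_peMr //; case/andP: r01.
have -> : Exp r (fun L c => f set0 - loss f L c + alpha *
    \sum_(u in firstfit (c :\: L) (considered f L)) weight f L u) =
    f set0 - r / 2 * (W - T) + alpha * EI.
  rewrite ExpD ExpZ -E_loss; congr (_ + _).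
  rewrite -mulN1r -ExpZ -[X in X + _](Exp_cst N r) -ExpD.
  by apply: eq_Exp => L c; rewrite mulN1r.
have r0 : 0 <= r by case/andP: r01.
have W0 := W_ge0; have z0 := f0 set0.
have gtr : 0 <= 1 + r by lra.
have rW0 : 0 <= r * W by apply: mulr_ge0.
(* [E_firstfit] and [E_blocked] give [EI >= r / 2 * W - r * K * EI], where
   [r * K = alpha / 4 <= 1 / 4]; hence the factor 2/5. *)
have EI_ge : 2 / 5 * (r * W) <= EI.
  have := ler_wpM2l r0 E_blocked; rewrite -/K => rb.
  have : r * (K * EI) = alpha / 4 * EI by rewrite mulrA rK.
  have EI0 : 0 <= EI.
    rewrite -(Exp_cst N r 0); apply: Exp_le => // L c; apply: sumr_ge0 => u.
    by case/firstfit_in/andP => _ /weight_gt0/ltW.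
  have : alpha * EI <= EI by rewrite ler_piMl.
  have := E_firstfit; lra.
(* [E_either_ge] bounds [(1 + r) / 2 * (W - T)] by [r * (W + f set0)]; the second factor [r] is the
   coin of the selected element. *)
have loss_le : r / 2 * (W - T) <= r * (r * (W + f set0)).
  have := E_either_ge; rewrite E_either E_sample => le.
  have le1 : (1 + r) / 2 * (W - T) <= r * (W + f set0) by lra.
  have := ler_wpM2l r0 le1.
  have : 0 <= r * (r * (r * (W + f set0))) by rewrite !mulr_ge0 // addr_ge0.
  have pos : 0 < 1 + r by lra.
  move=> h1 h2; rewrite -(ler_pM2l pos); lra.
have a2 : alpha * (2 / 5 * (r * W)) <= alpha * EI by apply: ler_wpM2l.
have rr : r * (r * W) <= alpha / 4 * (r * W) by apply: ler_wpM2r.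
have rz : r * (r * f set0) <= 1 / 16 * f set0.
  have r4 : r <= 1 / 4 by lra.
  by have := ler_pM r0 r0 r4 r4; rewrite mulrA => rr4; rewrite ler_wpM2r //; lra.
(* The quadratic loss costs 1/4 of the 2/5 gained, leaving 3/20. *)
have main : 15 / 16 * f set0 + 3 / 20 * (alpha * (r * W)) <=
    f set0 - r / 2 * (W - T) + alpha * EI by lra.
apply: le_trans main.
have OW : f O - 2 * f set0 <= 3 * (K * W).
  have := le_trans E_opt E_opt_le; rewrite -/K.
  have : W <= K * W by rewrite ler_peMl.
  lra.
(* As [alpha * (r * W) = s / 4 * (K * W)], [main] and [OW] yield at least [s / 80 * f O]; since
   [s <= 1], the remaining multiple of [f set0] is nonnegative. *)
pose s := (alpha / K) ^+ 2.
have s0 : 0 <= s by rewrite sqr_ge0.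
have s1 : s <= 1.
  have q0 : 0 <= alpha / K by rewrite divr_ge0 //; lra.
  have q1 : alpha / K <= 1 by rewrite ler_pdivrMr; lra.
  by rewrite /s expr_le1.
have -> : alpha ^+ 2 / (128 * K ^+ 2) = s / 128 by rewrite /s; field; lra.
have -> : alpha * (r * W) = s / 4 * (K * W) by rewrite rE /s -/K; field; lra.
have := ler_wpM2l s0 OW.
have : s * f set0 <= f set0 by rewrite ler_piMl.
have : 0 <= s * f O by rewrite mulr_ge0.
lra.
Qed.

End Expectations.

End Greedy.

(** * Interleaving the sample with the later arrivals *)

Section Merge.
Variable T : eqType.
Implicit Types (m : seq bool) (a b s : seq T).

(** Inverse to splitting a sequence by a mask. It stops when the list called for is empty, so a
    prefix of [b] yields the part of the merge already determined. *)
Fixpoint merge_mask m a b : seq T :=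
  match m, a, b with
  | true :: m', x :: a', _ => x :: merge_mask m' a' b
  | false :: m', _, y :: b' => y :: merge_mask m' a b'
  | _, _, _ => [::]
  end.

Lemma merge_mask_nil a b : merge_mask [::] a b = [::].
Proof. by case: a. Qed.

Lemma merge_mask_false m a y b :
  merge_mask (false :: m) a (y :: b) = y :: merge_mask m a b.
Proof. by case: a. Qed.

Lemma merge_maskK m s : size m = size s ->
  merge_mask m (mask m s) (mask (map negb m) s) = s.
Proof. by elim: m s => [|[] m IH] [|x s] //= [/IH->]; case: (mask m s). Qed.

Lemma perm_merge_mask m a b : size a = count id m -> size b = count negb m ->
  perm_eq (merge_mask m a b) (a ++ b).
Proof.
elim: m a b => [|[] m IH] a b.
- by move=> /size0nil-> /size0nil->.
- by case: a => //= x a [ea] eb; rewrite perm_cons IH.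
case: b => // y b ea [eb]; rewrite (merge_mask_false m a y b).
by rewrite perm_sym -[y :: b]cat1s perm_catCA perm_cons perm_sym IH.
Qed.

(** Later arrivals only extend the merged sequence; nothing already presented is revised. *)
Lemma merge_mask_cat m a b b' : exists z,
  merge_mask m a (b ++ b') = merge_mask m a b ++ z.
Proof.
elim: m a b => [|[] m IH] a b; first by exists [::]; rewrite !merge_mask_nil.
  case: a => [|x a]; first by exists [::].
  by have [z E] := IH a b; exists z; rewrite /= E.
case: b => [|y b].
  by exists (merge_mask (false :: m) a b'); case: a.
by have [z E] := IH a b; exists z; case: a E => [|x a] E; rewrite /= E.
Qed.

Lemma size_merge_mask m a b j : (count id m <= size a)%N ->
  (count negb (take j m) <= size b)%N -> (j <= size m)%N ->
  (j <= size (merge_mask m a b))%N.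
Proof.
elim: m a b j => [|[] m IH] [|x a] b [|j] //=; rewrite ?add0n ?add1n //; first exact: IH.
  by case: b => [|y b] //= ea eb js; apply: IH.
by case: b => [|y b] //= ea eb js; apply: IH.
Qed.

Lemma mem_merge_mask m a b : (count id m <= size a)%N ->
  (size b <= count negb m)%N -> {subset b <= merge_mask m a b}.
Proof.
elim: m a b => [|[] m IH] [|x a] [|y b] //=; rewrite ?add0n ?add1n // => ea eb v.
- by move=> vb; rewrite inE IH ?orbT.
- by rewrite !inE => /orP[->//|vb]; rewrite IH ?orbT.
by rewrite !inE => /orP[->//|vb]; rewrite IH ?orbT.
Qed.

Lemma merge_mask_sub m a b : {subset merge_mask m a b <= a ++ b}.
Proof.
elim: m a b => [|[] m IH] a b v; first by rewrite merge_mask_nil.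
  case: a => [|x a] //=; rewrite !inE => /orP[->//|/IH]; by rewrite mem_cat => ->; rewrite orbT.
case: b => [|y b]; first by case: a.
rewrite (merge_mask_false m a y b).
rewrite inE mem_cat inE => /orP[->|/IH]; first by rewrite orbT.
by rewrite mem_cat => /orP[->//|->]; rewrite !orbT.
Qed.

Lemma take_merge_mask_sub m a b j : (count id m <= size a)%N ->
  {subset take (count negb (take j m)) b <= take j (merge_mask m a b)}.
Proof.
elim: m a b j => [|[] m IH] a b [|j] //=; rewrite ?take0 ?add0n ?add1n //.
  case: a => [|x a] //= ea v vb; rewrite inE; by rewrite (IH a b j ea v vb) orbT.
case: b => [|y b] //= ea v vb.
suff : v \in y :: take j (merge_mask m a b) by case: a {ea}.
by move: vb; rewrite !inE => /orP[->//|/(IH a b j ea)->]; rewrite orbT.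
Qed.

End Merge.

(** * Uniform orders and random sample positions *)

Section Orders.
Variable N : finType.
Implicit Types (P : {set N}) (s : seq N) (sigma : {perm N}).

Lemma order_size s : is_order s -> size s = #|N|.
Proof. by move/perm_size->; rewrite -cardE. Qed.

Lemma order_uniq s : is_order s -> uniq s.
Proof. by move/perm_uniq->; apply: enum_uniq. Qed.

Lemma mem_order s u : is_order s -> u \in s.
Proof. by move/perm_mem->; rewrite mem_enum. Qed.

Lemma order_of_order sigma : is_order (order_of sigma).
Proof.
apply: uniq_perm; rewrite ?enum_uniq //.
  by rewrite map_inj_in_uniq ?enum_uniq // => u v _ _ /perm_inj.
move=> u; rewrite mem_enum inE; apply/mapP.
by exists ((sigma^-1)%g u); rewrite ?permKV // mem_enum.
Qed.

Lemma order_of_inj : injective (@order_of N).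
Proof.
move=> s1 s2 /eq_in_map E; apply/permP => u; apply: E.
by rewrite mem_enum.
Qed.

Lemma order_exists s : is_order s -> exists sigma, order_of sigma = s.
Proof.
move=> os; have ss := order_size os.
have lt (u : N) : (enum_rank u < size s)%N by rewrite ss; apply: ltn_ord.
have inj : injective (fun u : N => nth u s (enum_rank u)).
  move=> u v /= /eqP; rewrite (set_nth_default v u) //.
  by rewrite nth_uniq ?order_uniq // => /eqP/ord_inj/enum_rank_inj.
exists (perm inj); have [x0 _|N0] := pickP (xpredT : pred N); last first.
  have s0 : size s = 0 by rewrite ss; apply: eq_card0 => u; have := N0 u.
  by rewrite [RHS](size0nil s0); apply: size0nil; rewrite size_map -cardE -ss.
apply: (@eq_from_nth _ x0); rewrite size_map -cardE ?ss // => i iN.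
rewrite (nth_map x0) -?cardE // permE.
have -> : nth x0 (enum N) i = enum_val (Ordinal iN) by rewrite (enum_val_nth x0).
by rewrite enum_valK; apply: set_nth_default; rewrite ss.
Qed.

Definition perm_of_order s : {perm N} := odflt 1%g [pick sigma : {perm N} | order_of sigma == s].

Lemma perm_of_orderK s : is_order s -> order_of (perm_of_order s) = s.
Proof.
move=> /order_exists[sigma E]; rewrite /perm_of_order.
by case: pickP => [sigma' /eqP //|/(_ sigma)]; rewrite E eqxx.
Qed.

(** An injective map of the finite set of orders into itself preserves the uniform law. *)
Lemma reindex_order (V : nmodType) (h : seq N -> seq N) (F : seq N -> V) :
  (forall s, is_order s -> is_order (h s)) ->
  (forall s s', is_order s -> is_order s' -> h s = h s' -> s = s') ->
  \sum_(sigma : {perm N}) F (order_of sigma) =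
  \sum_(sigma : {perm N}) F (h (order_of sigma)).
Proof.
move=> oh ih; pose q sigma := perm_of_order (h (order_of sigma)).
have qE sigma : order_of (q sigma) = h (order_of sigma).
  by apply/perm_of_orderK/oh/order_of_order.
rewrite (reindex_inj (h := q)) /=; last first.
  move=> s1 s2 E; apply: order_of_inj; apply: ih; rewrite ?order_of_order //.
  by rewrite -!qE E.
by apply: eq_bigr => sigma _; rewrite qE.
Qed.

(* A set [P] of elements stands for the set of positions that [P] occupies in
   [enum N]. *)
Definition position_mask P : seq bool := [seq x \in P | x <- enum N].

Definition interleave P s : seq N :=
  merge_mask (position_mask P) (take #|P| s) (drop #|P| s).

(** The inverse of [interleave P], needed only for changing variables in the analysis. *)
Definition sample_first P s : seq N :=
  mask (position_mask P) s ++ mask (map negb (position_mask P)) s.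

Lemma size_position_mask P : size (position_mask P) = #|N|.
Proof. by rewrite size_map -cardE. Qed.

Lemma count_position_mask P : count id (position_mask P) = #|P|.
Proof. by rewrite count_map cardE /enum_mem -size_filter filter_predT. Qed.

Lemma count_negb_position_mask P : count negb (position_mask P) = (#|N| - #|P|)%N.
Proof.
by rewrite -(count_position_mask P) -(size_position_mask P) -(count_predC id) addKn.
Qed.

Lemma size_sample P s : is_order s -> size (take #|P| s) = #|P|.
Proof. by move=> os; rewrite size_takel // order_size // max_card. Qed.

Lemma take_sample_first P s : is_order s ->
  take #|P| (sample_first P s) = mask (position_mask P) s.
Proof.
move=> os; rewrite take_size_cat // size_mask ?count_position_mask //.
by rewrite size_position_mask order_size.
Qed.

Lemma interleaveK P s : is_order s -> interleave P (sample_first P s) = s.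
Proof.
move=> os; rewrite /interleave take_sample_first //.
rewrite drop_size_cat ?size_mask ?count_position_mask ?size_position_mask ?order_size //.
by rewrite merge_maskK // size_position_mask order_size.
Qed.

Lemma interleave_order P s : is_order s -> is_order (interleave P s).
Proof.
move=> os; have sz := order_size os; rewrite /is_order.
apply: (perm_trans _ (os)); rewrite -[X in perm_eq _ X](cat_take_drop #|P| s).
apply: perm_merge_mask; rewrite ?size_sample ?count_position_mask //.
by rewrite size_drop count_negb_position_mask sz.
Qed.

Lemma sample_first_order P s : is_order s -> is_order (sample_first P s).
Proof.
move=> os; have sz : size (sample_first P s) = #|N|.
  have szm : size (position_mask P) = size s by rewrite size_position_mask (order_size os).
  rewrite /sample_first size_cat size_mask // size_mask; last by rewrite size_map.
  rewrite count_map count_position_mask.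
  have -> : count (preim negb id) (position_mask P) = count negb (position_mask P) by [].
  by rewrite count_negb_position_mask subnKC // max_card.
have := @perm_merge_mask _ (position_mask P) (take #|P| (sample_first P s))
  (drop #|P| (sample_first P s)).
rewrite -/(interleave _ _) interleaveK // cat_take_drop.
rewrite count_position_mask count_negb_position_mask size_drop sz size_takel ?sz ?max_card //.
by move=> /(_ erefl erefl) H; apply: perm_trans os; rewrite perm_sym.
Qed.

Lemma sample_first_inj P s s' : is_order s -> is_order s' ->
  sample_first P s = sample_first P s' -> s = s'.
Proof. by move=> os os' E; rewrite -(interleaveK P os) E interleaveK. Qed.

(** For each fixed [sigma], a uniform [P] makes the sample uniform; hence the sample is independent
    of the order that the linear algorithm sees. *)
Lemma sample_of_order P sigma :
  [set v in take #|P| (sample_first P (order_of sigma))] = sigma @: P.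
Proof.
rewrite take_sample_first ?order_of_order // /order_of -map_mask.
apply/setP => v; rewrite inE -filter_mask; apply/mapP/imsetP => -[u].
  by rewrite mem_filter => /andP[uP _] ->; exists u.
by move=> uP ->; exists u; rewrite // mem_filter uP mem_enum.
Qed.

End Orders.

(** * The transformed algorithm *)

Section Reduction.
Variables (R : realType) (N : finType) (k : nat) (M : 'I_k -> matroid N).
Variable A : secretary_alg (linear_objective R N).
Implicit Types (f : {set N} -> R) (L P S c : {set N}) (s : seq N) (u v : N).

Definition sub_weight f L c : N -> R :=
  fun u => if u \in selectable M f L c then weight M f L u else 0.

(** The arrival [u] is the last element of [s]. The first [#|P|] arrivals are refused; afterwards
    the linear algorithm is replayed on the merged sequence up to [u], in which sample elements have
    weight 0. *)
Definition lift_select (t : seed A) P c s (y : {set N} -> R) : bool :=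
  if s isn't x :: s' then false else
  let u := last x s' in
  let L := [set v in take #|P| s] in
  let z := take (index u (interleave P s)).+1 (interleave P s) in
  [&& (#|P| < size s)%N, u \in selectable M y L c &
    select t z (@reveal R N (linear_objective R N) [set v in z] (sub_weight y L c))].

Lemma selectable_restrict f L S c u : L \subset S -> u \in S ->
  (u \in selectable M (restrict f S) L c) = (u \in selectable M f L c).
Proof. by move=> LS uS; rewrite !in_setI !inE considered_restrict. Qed.

Lemma sub_weight_restrict f L S c u : L \subset S -> u \in S ->
  sub_weight (restrict f S) L c u = sub_weight f L c u.
Proof.
by move=> LS uS; rewrite /sub_weight selectable_restrict // weight_restrict.
Qed.

Lemma lift_select_rcons (t : seed A) P c s u y :
  let s' := rcons s u in let L := [set v in take #|P| s'] in
  let z := take (index u (interleave P s')).+1 (interleave P s') in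
  lift_select t P c s' y =
  [&& (#|P| < size s')%N, u \in selectable M y L c &
    select t z (@reveal R N (linear_objective R N) [set v in z] (sub_weight y L c))].
Proof. by case: s => [|x s] //=; rewrite last_rcons. Qed.

(** The online decisions agree with a run of [A] on the complete interleaved order with the prices
    of the full [f]. *)
Lemma lift_selectE (t : seed A) P c f s u : is_order s ->
  let arrived := take (index u s).+1 s in
  let L := [set v in take #|P| s] in
  lift_select t P c arrived (restrict f [set v in arrived]) =
  (u \in selectable M f L c :&: output t (sub_weight f L c) (interleave P s)).
Proof.
move=> os arrived L; set S := [set v in arrived].
have us : (index u s < size s)%N by rewrite index_mem mem_order.
have sza : size arrived = (index u s).+1 by rewrite size_takel.
have arrE : arrived = rcons (take (index u s) s) u.
  by rewrite /arrived (take_nth u) // nth_index ?mem_order.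
rewrite [LHS](_ : _ = lift_select t P c (rcons (take (index u s) s) u) (restrict f S)); last by rewrite arrE.
rewrite lift_select_rcons -arrE sza ltnS in_setI.
have [Pu|uP] /= := leqP #|P| (index u s); last first.
  (* A sampled element is refused on the left, and is not selectable on the right. *)
  apply/esym/negbTE; rewrite negb_and !inE; apply/orP; left.
  by have -> : u \in take #|P| s by rewrite in_take // mem_order.
have tP : take #|P| arrived = take #|P| s by rewrite take_takel // ltnW.
rewrite tP -/L.
have LS : L \subset S.
  by apply/subsetP => v; rewrite !inE -tP; apply: mem_take.
have uS : u \in S by rewrite inE arrE mem_rcons mem_head.
rewrite selectable_restrict //; congr andb; rewrite inE.
have [z zE] : exists z, interleave P s = interleave P arrived ++ z.
  have := merge_mask_cat (position_mask P) (take #|P| s) (drop #|P| arrived)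
    (drop (index u s).+1 s).
  have -> : drop #|P| arrived ++ drop (index u s).+1 s = drop #|P| s.
    by rewrite -[in RHS](cat_take_drop (index u s).+1 s) drop_cat sza ltnS Pu.
  by rewrite /interleave tP.
have szP : (count id (position_mask P) <= size (take #|P| s))%N.
  by rewrite count_position_mask size_sample.
have uz : u \in interleave P arrived.
  rewrite /interleave tP; apply: mem_merge_mask => //.
    rewrite size_drop count_negb_position_mask; apply: leq_sub2r.
    by rewrite -(order_size os) sza.
  by rewrite arrE drop_rcons ?mem_rcons ?mem_head // size_takel // ltnW.
have lt : ((index u (interleave P arrived)).+1 <= size (interleave P arrived))%N.
  by rewrite index_mem.
rewrite zE index_cat uz takel_cat //.
set a := take _ _; congr (select t a _).
(* Only merged elements are shown to [A]; they have all arrived, so their prices are already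
   final. *)
apply/boolp.funext => v /=; case: ifP => // va; apply: sub_weight_restrict => //.
have : v \in interleave P arrived by move: va; rewrite inE; apply: mem_take.
by move/merge_mask_sub; rewrite cat_take_drop inE.
Qed.

End Reduction.

(** * Random variables with finitely many values, and mixtures *)

Section FiniteExpectation.
Import boolp classical_sets functions cardinality measurable_realfun numfun lebesgue_integral interval_inference.
Local Open Scope classical_set_scope.
Local Open Scope ring_scope.

Definition mass d (T : measurableType d) (R : realType) (P : probability T R)
    (F : Type) (Z : T -> F) (z : F) : R := fine (P (Z @^-1` [set z])).

(** Measurability for maps to a type without a sigma-algebra, adequate when finitely many values are
    taken. *)
Definition measurable_fibers d (T : measurableType d) (F : Type) (Z : T -> F) :=
  forall z, measurable (Z @^-1` [set z]).

Section Mass.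
Context d (T : measurableType d) (R : realType) (P : probability T R).
Variables (F : finType) (Z : T -> F).
Hypothesis mZ : measurable_fibers Z.

Lemma mass_ge0 z : 0 <= mass P Z z.
Proof. exact: fine_ge0. Qed.

Lemma mass_fineK z : (mass P Z z)%:E = P (Z @^-1` [set z]).
Proof. by rewrite /mass fineK // fin_num_measure. Qed.

Lemma expectation_mass (g : F -> R) : (forall z, 0 <= g z) ->
  expectation P (fun t => g (Z t)) = (\sum_z g z * mass P Z z)%:E.
Proof.
move=> g0; rewrite unlock.
have E t : (g (Z t))%:E = (\sum_z (g z * \1_(Z @^-1` [set z]) t)%:E)%E.
  rewrite (bigD1 (Z t)) //= big1 ?adde0; last first.
    move=> z zZ; rewrite indicE memNset ?mulr0 //= => e.
    by rewrite e eqxx in zZ.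
  by rewrite indicE mem_set //= mulr1.
under eq_integral do rewrite E.
rewrite ge0_integral_sum //; last 2 first.
- by move=> z; apply/measurable_EFinP; apply: measurable_funM.
- by move=> z t _; rewrite lee_fin mulr_ge0 // indicE.
rewrite -sumEFin; apply: eq_bigr => z _.
rewrite (integralZl_indic _ (fun=> Z @^-1` [set z])) //; last first.
  by rewrite ltNge g0.
by rewrite integral_indic // setIT EFinM mass_fineK.
Qed.

Lemma sum_mass : \sum_z mass P Z z = 1.
Proof.
have /esym := expectation_mass (g := fun=> 1) (fun=> ler01).
rewrite -/(cst (1 : R)) expectation_cst => -[E].
by rewrite -[RHS]E; apply: eq_bigr => z _; rewrite mul1r.
Qed.

End Mass.

Section Mixture.
Context d (T : measurableType d) (R : realType) (P : probability T R).

Definition with_index (i : nat) (t : T) : T * nat := (t, i).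

Let measurable_with_index i : measurable_fun setT (with_index i).
Proof. exact: pair2_measurable. Qed.

HB.instance Definition _ i :=
  @isMeasurableFun.Build _ _ T (T * nat)%type (with_index i) (measurable_with_index i).

Variables (p : nat -> {nonneg R}) (n : nat).

(** The law of a point of [P] together with an independent index [i < n] of probability [p i]. *)
Definition mixture : set (T * nat) -> \bar R :=
  msum (fun i => mscale (p i) (distribution P (with_index i))) n.

Hypothesis p1 : \sum_(i < n) (p i)%:num = 1.

Let mixture0 : mixture set0 = 0%E. Proof. exact: measure0. Qed.

Let mixture_ge0 A : (0 <= mixture A)%E. Proof. exact: measure_ge0. Qed.

Let mixture_sigma_additive : semi_sigma_additive mixture.
Proof. exact: measure_semi_sigma_additive. Qed.

HB.instance Definition _ := isMeasure.Build _ _ _ mixture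
  mixture0 mixture_ge0 mixture_sigma_additive.

Let mixture_setT : mixture setT = 1%E.
Proof.
rewrite /mixture /msum -p1 -sumEFin; apply: eq_bigr => i _.
rewrite /mscale.
rewrite -[RHS]mule1; congr (_ * _)%E.
exact: (@probability_setT _ _ _ (distribution P (with_index i))).
Qed.

HB.instance Definition _ := Measure_isProbability.Build _ _ _ mixture mixture_setT.

Definition mixture_probability : probability (T * nat)%type R := mixture.

Lemma mass_mixture (F : Type) (Z : T * nat -> F) z : measurable_fibers Z ->
  mass mixture_probability Z z =
  \sum_(i < n) (p i)%:num * mass P (fun t => Z (t, val i)) z.
Proof.
move=> mZ; rewrite /mass /= /mixture /msum.
have slice i : measurable ((fun t => Z (t, i)) @^-1` [set z]).
  by have := @measurable_with_index i measurableT _ (mZ z); rewrite setTI.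
rewrite -sum_fine => [|i _]; last first.
  by rewrite /mscale /= fin_numM // fin_num_measure.
apply: eq_bigr => i _; rewrite /mscale /= fineM // fin_num_measure //.
Qed.

End Mixture.

Lemma measurable_slices d d' (T : measurableType d) (T' : measurableType d')
    (h : T * nat -> T') :
  (forall i, measurable_fun setT (fun t => h (t, i))) -> measurable_fun setT h.
Proof.
move=> mh _ Y mY; rewrite setTI.
have -> : h @^-1` Y = \bigcup_i ((fun t => h (t, i)) @^-1` Y `*` [set i]).
  apply/seteqP; split=> [[t i] Yt|[t i] [j _ [/= Yt ->]]] //.
  by exists i.
apply: bigcupT_measurable => i; apply: measurableX => //.
by rewrite -[X in measurable X]setTI; apply: mh.
Qed.

Lemma measurable_fibers_slices d (T : measurableType d) (F : Type) (Z : T * nat -> F) :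
  (forall i, measurable_fibers (fun t => Z (t, i))) -> measurable_fibers Z.
Proof.
move=> mZ z; have -> : Z @^-1` [set z] =
    \bigcup_i ((fun t => Z (t, i)) @^-1` [set z] `*` [set i]).
  apply/seteqP; split=> [[t i] Zt|[t i] [j _ [/= Zt ->]]] //.
  by exists i.
by apply: bigcupT_measurable => i; apply: measurableX => //; apply: mZ.
Qed.

Section FiniteRv.
Context d (T : measurableType d).

Lemma measurable_fibers_cst (F : Type) (a : F) : measurable_fibers (fun _ : T => a).
Proof.
move=> z; have [->|az] := pselect (a = z).
  by rewrite (_ : _ @^-1` _ = setT) //; apply/seteqP.
by rewrite (_ : _ @^-1` _ = set0) //; apply/seteqP; split.
Qed.

Lemma measurable_fibers_comp (F : finType) (G : Type) (g : F -> G) (Z : T -> F) :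
  measurable_fibers Z -> measurable_fibers (fun t => g (Z t)).
Proof.
move=> mZ y; rewrite (_ : _ @^-1` _ =
    \bigcup_(z in [set z | g z = y]) (Z @^-1` [set z])).
  by apply: fin_bigcup_measurable => // z _; apply: mZ.
by apply/seteqP; split=> [t gy|t [z gz /= ->]] //; exists (Z t).
Qed.

Lemma measurable_fibers_ffun (I : finType) (F : Type) (Z : I -> T -> F) :
  (forall i, measurable_fibers (Z i)) -> measurable_fibers (fun t => [ffun i => Z i t]).
Proof.
move=> mZ y; rewrite (_ : _ @^-1` _ =
    \bigcap_(i in [set: I]) (Z i @^-1` [set y i])).
  by apply: fin_bigcap_measurable => // i _; apply: mZ.
apply/seteqP; split=> [t <- i _|t Zy] /=; first by rewrite ffunE.
by apply/ffunP => i; rewrite ffunE; apply: Zy.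
Qed.

Lemma measurable_fibers_pair (F G : Type) (Z : T -> F) (Y : T -> G) :
  measurable_fibers Z -> measurable_fibers Y -> measurable_fibers (fun t => (Z t, Y t)).
Proof.
move=> mZ mY [z y]; rewrite (_ : _ @^-1` _ = Z @^-1` [set z] `&` Y @^-1` [set y]).
  by apply: measurableI; [apply: mZ|apply: mY].
by apply/seteqP; split=> t /= => [[-> ->]|[-> ->]].
Qed.

(** All [Z z] are gathered into one function-valued variable, which is then evaluated at the random
    index. *)
Lemma measurable_fibers_depend (F G : finType) (m : T -> F) (Z : F -> T -> G) :
  measurable_fibers m -> (forall z, measurable_fibers (Z z)) -> measurable_fibers (fun t => Z (m t) t).
Proof.
move=> mm mZ; have mY := measurable_fibers_pair mm (measurable_fibers_ffun mZ).
have := @measurable_fibers_comp _ _ (fun p : F * {ffun F -> G} => p.2 p.1) _ mY.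
by congr measurable_fibers; apply/funext => t /=; rewrite ffunE.
Qed.

Variables (R : realType) (P : probability T R).

Definition mean (h : T -> R) : R := fine (expectation P h).

Lemma mean_mass (F : finType) (Z : T -> F) (g : F -> R) : measurable_fibers Z ->
  (forall z, 0 <= g z) -> mean (fun t => g (Z t)) = \sum_z g z * mass P Z z.
Proof. by move=> mZ g0; rewrite /mean expectation_mass. Qed.

Lemma expectation_mean (F : finType) (Z : T -> F) (g : F -> R) : measurable_fibers Z ->
  (forall z, 0 <= g z) -> expectation P (fun t => g (Z t)) = (mean (fun t => g (Z t)))%:E.
Proof. by move=> mZ g0; rewrite mean_mass // expectation_mass. Qed.

Lemma expectation_sum_mean (I F : finType) (Z : I -> T -> F) (g : I -> F -> R) :
  (forall i, measurable_fibers (Z i)) -> (forall i z, 0 <= g i z) ->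
  expectation P (fun t => \sum_i g i (Z i t)) =
  (\sum_i mean (fun t => g i (Z i t)))%:E.
Proof.
move=> mZ g0; have mY := measurable_fibers_ffun mZ.
have E i : mean (fun t => g i (Z i t)) =
    \sum_(z : {ffun I -> F}) g i (z i) * mass P (fun t => [ffun i => Z i t]) z.
  rewrite -(@mean_mass _ _ (fun z : {ffun I -> F} => g i (z i)) mY) //.
  by congr mean; apply/funext => t; rewrite ffunE.
have G0 (z : {ffun I -> F}) : 0 <= \sum_i g i (z i) by apply: sumr_ge0.
transitivity (\sum_(z : {ffun I -> F}) (\sum_i g i (z i)) *
    mass P (fun t => [ffun i => Z i t]) z)%:E.
  rewrite -(expectation_mass P mY G0); congr expectation; apply/funext => t.
  by apply: eq_bigr => i _; rewrite ffunE.
congr EFin; under eq_bigr do rewrite mulr_suml.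
by rewrite exchange_big; apply: eq_bigr => i _; rewrite E.
Qed.

(** The constants stand on both sides so that no subtraction spoils the nonnegativity of [g] and
    [h]. *)
Lemma mean_le (F : finType) (Z : T -> F) (g h : F -> R) (a b : R) : measurable_fibers Z ->
  (forall z, 0 <= g z) -> (forall z, 0 <= h z) ->
  (forall z, g z + a <= h z + b) ->
  mean (fun t => g (Z t)) + a <= mean (fun t => h (Z t)) + b.
Proof.
move=> mZ g0 h0 gh; rewrite !mean_mass //.
have m1 := sum_mass P mZ.
rewrite -[a]mulr1 -[b]mulr1 -m1 !mulr_sumr -!big_split /=.
by apply: ler_sum => z _; rewrite -!mulrDl ler_wpM2r // mass_ge0.
Qed.

End FiniteRv.

Lemma mean_mixture d (T : measurableType d) (R : realType) (P : probability T R)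
    (p : nat -> {nonneg R}) n (p1 : \sum_(i < n) (p i)%:num = 1)
    (F : finType) (Z : T * nat -> F) (g : F -> R) :
  measurable_fibers Z -> (forall z, 0 <= g z) ->
  mean (mixture_probability P p1) (fun t => g (Z t)) =
  \sum_(i < n) (p i)%:num * mean P (fun t => g (Z (t, val i))).
Proof.
move=> mZ g0; rewrite mean_mass //.
under eq_bigr do rewrite mass_mixture // mulr_sumr.
rewrite exchange_big; apply: eq_bigr => i _ /=.
have mZi : measurable_fibers (fun t => Z (t, val i)).
  move=> z; have := measurable_ysection (val i) (mZ z).
  by rewrite ysectionE.
by rewrite mean_mass // mulr_sumr; apply: eq_bigr => z _; rewrite mulrCA.
Qed.

End FiniteExpectation.

(** * Expected value of the transformed algorithm *)

Section Outputs.
Variables (R : realType) (N : finType) (O : objective R N) (A : secretary_alg O).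

Lemma measurable_fibers_bool d (T : measurableType d) (h : T -> bool) :
  measurable_fun classical_sets.setT h -> measurable_fibers h.
Proof.
by move=> mh z; rewrite -[X in measurable X]classical_sets.setTI; apply: mh.
Qed.

Lemma measurable_fibers_output x s : measurable_fibers (fun t : seed A => output t x s).
Proof.
pose h u (t : seed A) := let a := take (index u s).+1 s in
  select t a (reveal [set v in a] x).
have mh u : measurable_fibers (h u) by apply/measurable_fibers_bool/measurable_select.
have := measurable_fibers_comp (fun b : {ffun N -> bool} => [set u | b u]) (measurable_fibers_ffun mh).
congr measurable_fibers; apply: boolp.funext => t; apply/setP => u.
by rewrite !inE ffunE.
Qed.

End Outputs.

Section Algorithm.
Import interval_inference.
Variables (R : realType) (N : finType) (k : nat) (M : 'I_k -> matroid N).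
Variable A : secretary_alg (linear_objective R N).
Variable r : R.
Hypothesis r01 : 0 <= r <= 1.
Implicit Types (f : {set N} -> R) (L P c : {set N}) (s : seq N) (u v : N).

(* The random positions of the sample and the random set of selectable elements
   are encoded by a natural number. *)
Definition decode (i : nat) : {set N} * {set N} :=
  nth (set0, set0) (enum {: {set N} * {set N}}) i.

Lemma sum_decode (F : {set N} * {set N} -> R) :
  \sum_(i < #|{: {set N} * {set N}}|) F (decode i) = \sum_P \sum_c F (P, c).
Proof.
rewrite pair_bigA cardE -(big_mkord xpredT (fun i => F (decode i))) /decode.
rewrite -(big_nth (set0, set0) xpredT F) big_enum.
by apply: eq_bigr => -[P c].
Qed.

Lemma coin_ge0 i : 0 <= bern 2^-1 (decode i).1 * bern r (decode i).2.
Proof. by rewrite mulr_ge0 ?bern_ge0 //; lra. Qed.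

Definition coin i : {nonneg R} := NngNum (coin_ge0 i).

Lemma sum_coin : \sum_(i < #|{: {set N} * {set N}}|) (coin i)%:num = 1.
Proof.
rewrite (sum_decode (fun p => bern 2^-1 p.1 * bern r p.2)) /=.
under eq_bigr do rewrite -mulr_sumr sum_bern mulr1.
by rewrite sum_bern.
Qed.

Lemma measurable_lift_select s y : measurable_fun classical_sets.setT
  (fun t : seed A * nat => lift_select M t.1 (decode t.2).1 (decode t.2).2 s y).
Proof.
apply: measurable_slices => i /=; rewrite /lift_select.
case: s => [|x s]; first exact: measurable_cst.
case: (_ < _)%N => /=; last exact: measurable_cst.
case: (_ \in _) => /=; last exact: measurable_cst.
exact: measurable_select.
Qed.

Definition lift : secretary_alg (submodular_objective R N) :=
  @SecretaryAlg R N (submodular_objective R N) _ (seed A * nat)%type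
    (mixture_probability (seed_law A) sum_coin)
    (fun t s y => lift_select M t.1 (decode t.2).1 (decode t.2).2 s y)
    measurable_lift_select.

Lemma lift_output (t : seed lift) f s : is_order s ->
  let L := [set v in take #|(decode t.2).1| s] in
  output t f s = selectable M f L (decode t.2).2 :&:
    output t.1 (sub_weight M f L (decode t.2).2) (interleave (decode t.2).1 s).
Proof.
by move=> os L; apply/setP => u; rewrite -lift_selectE // inE.
Qed.

Lemma sub_weight_ge0 f L c : valid (o := linear_objective R N) (sub_weight M f L c).
Proof.
move=> u; rewrite /sub_weight; case: ifP => //.
by rewrite !inE => /andP[_ /weight_gt0/ltW].
Qed.

Lemma lift_feasible : feasible M A -> feasible M lift.
Proof.
move=> fA f _ t s os i; rewrite lift_output //.
apply: indep_sub (subsetIr _ _) (fA _ _ _ _ _ _); first exact: sub_weight_ge0.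
exact: interleave_order.
Qed.

End Algorithm.

Section Value.
Variables (R : realType) (N : finType) (k : nat) (M : 'I_k -> matroid N).
Variable A : secretary_alg (linear_objective R N).
Implicit Types (f : {set N} -> R) (w : N -> R) (L P c : {set N}) (s : seq N).

Local Notation perms := #|{perm N}|%:R.
Local Notation linear := (linear_objective R N).

Lemma perms_gt0 : 0 < perms :> R.
Proof. by rewrite ltr0n; apply/card_gt0P; exists 1%g. Qed.

Lemma average_cst (a : R) : \sum_(sigma : {perm N}) a / perms = a.
Proof. by rewrite sumr_const -[X in X = _]mulr_natr mulfVK // gt_eqF // perms_gt0. Qed.

Lemma exists_opt w : exists OPT, is_opt M (O := linear) w OPT.
Proof.
have [I cI maxI] := arg_maxP (fun I : {set N} => \sum_(u in I) w u) (cindep0 M).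
exists I; split; first exact/cindepP.
by move=> J /cindepP; apply: maxI.
Qed.

Lemma sum_sub_weight f L c (Q : {set N}) :
  \sum_(u in Q) sub_weight M f L c u =
  \sum_(u in selectable M f L c :&: Q) weight M f L u.
Proof.
rewrite big_mkcond [RHS]big_mkcond; apply: eq_bigr => u _.
by rewrite in_setI /sub_weight; case: (u \in Q); case: (u \in selectable _ _ _ _).
Qed.

Lemma sub_weight_opt f L c OPT : is_opt M (O := linear) (sub_weight M f L c) OPT ->
  \sum_(u in firstfit M (c :\: L) (considered M f L)) weight M f L u <=
  \sum_(u in OPT) sub_weight M f L c u.
Proof.
move=> [_ /(_ (firstfit M (c :\: L) (considered M f L)))] /=.
move=> /(_ (elimT (cindepP _ _) (firstfit_cindep _ _ _))); apply: le_trans.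
rewrite sum_sub_weight (setIidPr _) //; apply/subsetP => u /firstfit_in /andP[uc uD].
by rewrite !inE uD andbT; move: uc; rewrite inE.
Qed.

Section Fixed.
(** [rho] rearranges the arrivals after the sample, knowing [mu t]. It is the identity in the plain
    model, and the adversary in the order-oblivious one, where [mu] is the requested sample size. *)
Variables (F : finType) (mu : seed A -> F) (rho : F -> {set N} -> seq N -> seq N).
Hypothesis mmu : measurable_fibers mu.
Hypothesis rho_order : forall z P s, is_order s -> is_order (rho z P s).
Hypothesis rho_sample : forall z P s, is_order s -> take #|P| (rho z P s) = take #|P| s.

(* The order seen by [A] when, sampling at positions [P], the order [s] would
   have been presented to it in the absence of the adversary. *)
Definition presented z P s := interleave P (rho z P (sample_first P s)).

Lemma measurable_fibers_presented (w : N -> R) (h : F -> seq N) :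
  measurable_fibers (fun t : seed A => output t (w : instance linear) (h (mu t))).
Proof.
apply: (measurable_fibers_depend (Z := fun z t => output t (w : instance linear) (h z)) mmu).
by move=> z; apply: measurable_fibers_output.
Qed.

Variables (f : {set N} -> R) (alpha : R).
Hypotheses (f0 : forall X, 0 <= f X) (sf : submodular f).
(** The positions [Q sigma] may depend on the order: once the sample is fixed to be [L], they are
    the preimage of [L] under [sigma]. *)
Hypothesis value_A : forall (w : N -> R) OPT (Q : {perm N} -> {set N}),
  (forall u, 0 <= w u) -> is_opt M (O := linear) w OPT ->
  ((alpha * \sum_(u in OPT) w u)%:E <= expectation (seed_law A) (fun t =>
    ((\sum_(sigma : {perm N}) \sum_(u in output t (w : instance linear)
       (presented (mu t) (Q sigma) (order_of sigma))) w u) / perms)%R))%E.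

(** The expectation conditional on the sample [L] and the coins [c], the order [sigma] being still
    uniform. *)
Definition sampled_value L c : R := \sum_(sigma : {perm N})
  mean (seed_law A) (fun t => f (selectable M f L c :&:
    output t (sub_weight M f L c : instance linear)
      (presented (mu t) ((sigma^-1)%g @: L) (order_of sigma))) / perms).

(** With [L] and [c] fixed the prices are fixed weights, so [A] earns [alpha] times the linear
    optimum, hence [alpha] times first-fit; [value_ge] converts this into [f] for every seed and
    order. *)
Lemma sampled_value_ge L c : 0 <= alpha ->
  f set0 - loss M f L c + alpha *
    \sum_(u in firstfit M (c :\: L) (considered M f L)) weight M f L u
  <= sampled_value L c.
Proof.
move=> a0; set w := sub_weight M f L c; have [OPT hOPT] := exists_opt w.
pose Y (sigma : {perm N}) t := output t (w : instance linear)
  (presented (mu t) ((sigma^-1)%g @: L) (order_of sigma)).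
have mY sigma : measurable_fibers (Y sigma).
  exact: (measurable_fibers_presented w (fun z => presented z ((sigma^-1)%g @: L) (order_of sigma))).
have mZ := measurable_fibers_ffun mY.
have w0 : forall u, 0 <= w u by apply: sub_weight_ge0.
pose G (z : {ffun {perm N} -> {set N}}) : R :=
  \sum_sigma f (selectable M f L c :&: z sigma) / perms.
pose H (z : {ffun {perm N} -> {set N}}) : R :=
  (\sum_sigma \sum_(u in z sigma) w u) / perms.
have p0 := ltW perms_gt0.
have G0 z : 0 <= G z by apply: sumr_ge0 => sigma _; rewrite divr_ge0.
have H0 z : 0 <= H z.
  by rewrite divr_ge0 //; apply: sumr_ge0 => sigma _; apply: sumr_ge0.
have EG : sampled_value L c = mean (seed_law A) (fun t => G [ffun sigma => Y sigma t]).
  have /= := @expectation_sum_mean _ (seed A) _ (seed_law A) _ _ Y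
    (fun _ Q => f (selectable M f L c :&: Q) / perms) mY.
  move=> /(_ (fun _ _ => divr_ge0 (f0 _) p0)) E.
  have E' := expectation_mean (seed_law A) mZ G0.
  apply: EFin_inj; rewrite -E' /sampled_value -E; congr expectation.
  by apply: boolp.funext => t; apply: eq_bigr => sigma _; rewrite ffunE.
have EH : alpha * \sum_(u in OPT) w u <=
    mean (seed_law A) (fun t => H [ffun sigma => Y sigma t]).
  rewrite -lee_fin -(expectation_mean (seed_law A) mZ H0).
  apply: le_trans (value_A (fun sigma => (sigma^-1)%g @: L) w0 hOPT) _.
  rewrite le_eqVlt; apply/orP; left; apply/eqP; congr expectation.
  apply: boolp.funext => t; congr (_ / _); apply: eq_bigr => sigma _.
  by rewrite ffunE.
have HG z : H z + f set0 <= G z + loss M f L c.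
  rewrite -[f set0]average_cst -[loss _ _ _ _]average_cst /H /G mulr_suml -!big_split /=.
  apply: ler_sum => sigma _; rewrite -!mulrDl ler_pM2r ?invr_gt0 ?perms_gt0 //.
  rewrite sum_sub_weight addrC; apply: value_ge => //; exact: subsetIl.
have := mean_le (seed_law A) mZ H0 G0 HG; rewrite -EG.
have := ler_wpM2l a0 (sub_weight_opt hOPT); rewrite -/w; lra.
Qed.

Hypotheses (hk : (0 < k)%N) (halpha : 0 <= alpha <= 1).
Variable r : R.
Hypotheses (r01 : 0 <= r <= 1) (rE : r = alpha / (4 * k%:R)).

Lemma lift_expected : expected_value (A := lift M A r01) f
    (fun t s => rho (mu t.1) (decode N t.2).1 s) = (Exp r sampled_value)%:E.
Proof.
have p0 := ltW perms_gt0.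
pose out P c s (t : seed A) : {set N} :=
  let L := [set v in take #|P| s] in selectable M f L c :&:
    output t (sub_weight M f L c : instance linear) (interleave P (rho (mu t) P s)).
have mout P c s : measurable_fibers (out P c s).
  apply: (measurable_fibers_comp (fun Q => _ :&: Q)).
  exact: (measurable_fibers_presented _ (fun z => interleave P (rho z P s))).
pose out' (sigma : {perm N}) (t : seed A * nat) :=
  out (decode N t.2).1 (decode N t.2).2 (order_of sigma) t.1.
have mout' sigma : measurable_fibers (out' sigma).
  by apply: measurable_fibers_slices => i; apply: mout.
have g0 (Q : {set N}) : 0 <= f Q / perms by rewrite divr_ge0.
have -> : expected_value (A := lift M A r01) f
    (fun t s => rho (mu t.1) (decode N t.2).1 s) =
    (\sum_sigma mean (mixture_probability (seed_law A) (sum_coin N r01))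
      (fun t => f (out' sigma t) / perms))%:E.
  rewrite -(expectation_sum_mean _ mout' (fun _ => g0)); congr expectation.
  apply: boolp.funext => t; rewrite mulr_suml; apply: eq_bigr => sigma _.
  rewrite lift_output; last by apply/rho_order/order_of_order.
  by rewrite rho_sample ?order_of_order.
congr EFin; pose e P c s := mean (seed_law A) (fun t => f (out P c s t) / perms).
transitivity (\sum_P \sum_c bern 2^-1 P * bern r c *
    \sum_(sigma : {perm N}) e P c (order_of sigma)).
  rewrite -(sum_decode (fun p => bern 2^-1 p.1 * bern r p.2 *
    \sum_(sigma : {perm N}) e p.1 p.2 (order_of sigma))).
  under [RHS]eq_bigr do rewrite mulr_sumr.
  rewrite [RHS]exchange_big; apply: eq_bigr => sigma _.
  by rewrite (mean_mixture _ _ (mout' sigma) g0).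
(* Replacing the uniform order by its image under [sample_first P] makes [presented] the order seen
   by [A]. *)
under eq_bigr => P _. under eq_bigr => c _.
  rewrite (reindex_order (h := sample_first P)); first last.
  - by move=> s s'; apply: sample_first_inj.
  - by move=> s; apply: sample_first_order.
  rewrite mulr_sumr; over. over.
under eq_bigr do rewrite exchange_big.
rewrite exchange_big /Exp /sampled_value.
under [RHS]eq_bigr => L _ do under eq_bigr => c _ do rewrite mulr_sumr.
under [RHS]eq_bigr => L _ do rewrite exchange_big mulr_sumr.
rewrite [RHS]exchange_big /=; apply: eq_bigr => sigma _.
have inj : injective (fun L : {set N} => (sigma^-1)%g @: L) by apply/imset_inj/perm_inj.
(* For fixed [sigma], sum over the sample [L] instead of its positions; both are uniform, so the
   weights agree. *)
rewrite (reindex_inj inj) /=; apply: eq_bigr => L _.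
rewrite mulr_sumr; apply: eq_bigr => c _; rewrite -mulrA !bern_half; congr (_ * (_ * _)).
rewrite /e /out sample_of_order.
have -> // : sigma @: ((sigma^-1)%g @: L) = L.
rewrite -imset_comp -[RHS]imset_id; apply: eq_imset => u /=; exact: permKV.
Qed.

Lemma lift_value O : cindep M O ->
  ((alpha ^+ 2 / (128 * k%:R ^+ 2) * f O)%:E <= expected_value (A := lift M A r01) f
    (fun t s => rho (mu t.1) (decode N t.2).1 s))%E.
Proof.
move=> cO; rewrite lift_expected lee_fin.
apply: le_trans (Exp_value_ge sf f0 r01 cO hk halpha rE) _.
apply: Exp_le => // L c; apply: sampled_value_ge; by case/andP: halpha.
Qed.

End Fixed.
End Value.

(** * Adversarial orders *)

Lemma exists_seq_min (R : realType) (T : eqType) (h : T -> R) (s : seq T) x :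
  x \in s -> exists2 y, y \in s & forall z, z \in s -> h y <= h z.
Proof.
elim: s x => // a [|b s] IH x xs.
  by exists a => [|z]; rewrite !inE // => /eqP->.
have [y ys ymin] := IH b (mem_head _ _).
have [le|lt] := leP (h a) (h y).
  exists a => [|z]; rewrite ?mem_head // inE => /orP[/eqP->//|/ymin].
  exact: le_trans.
exists y => [|z]; first by rewrite inE ys orbT.
by rewrite inE => /orP[/eqP->|/ymin //]; apply: ltW.
Qed.

Section Robust.
Variables (R : realType) (N : finType).
Variables (A : secretary_alg (linear_objective R N)) (alpha : R) (m : seed A -> nat).
Hypotheses (mm : measurable_fun classical_sets.setT m).
Hypothesis (mN : forall t, (m t <= #|N|)%N).
Local Notation linear := (linear_objective R N).
Local Notation perms := #|{perm N}|%:R.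

Definition sample_size (t : seed A) : 'I_#|N|.+1 := inord (m t).

Lemma val_sample_size t : val (sample_size t) = m t.
Proof. by rewrite /= inordK // ltnS. Qed.

Lemma measurable_fibers_sample_size : measurable_fibers sample_size.
Proof.
move=> z; rewrite (_ : classical_sets.preimage _ _ =
  classical_sets.preimage m (classical_sets.set1 (val z))).
  by rewrite -[X in measurable X]classical_sets.setTI; apply: mm.
apply/classical_sets.seteqP; split=> t /= => [<-|e].
  by rewrite val_sample_size.
by apply: val_inj; rewrite val_sample_size.
Qed.

Variables (w : N -> R) (OPT : {set N}).
Hypothesis w0 : forall u, 0 <= w u.
Hypothesis value_A : forall adv, adversary adv ->
  ((alpha * value (o := linear) w OPT)%:E <=
     expected_value (A := A) (w : instance linear)
       (fun t s => take (m t) s ++ adv (take (m t) s)))%E.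

(** The share of the expected value due to seeds requesting [j] elements, when the order is [s]. *)
Definition value_at (j : 'I_#|N|.+1) (s : seq N) : R :=
  mean (seed_law A) (fun t => (sample_size t == j)%:R *
    ((\sum_(u in output t (w : instance linear) s) w u) / perms)).

Lemma expected_value_at (o : 'I_#|N|.+1 -> {perm N} -> seq N) :
  expectation (seed_law A) (fun t => ((\sum_(sigma : {perm N})
    \sum_(u in output t (w : instance linear) (o (sample_size t) sigma)) w u)
      / perms)%R) =
  (\sum_(sigma : {perm N}) \sum_j value_at j (o j sigma))%:E.
Proof.
pose Z (p : {perm N} * 'I_#|N|.+1) t :=
  (sample_size t, output t (w : instance linear) (o p.2 p.1)).
pose g (p : {perm N} * 'I_#|N|.+1) (z : 'I_#|N|.+1 * {set N}) : R :=
  (z.1 == p.2)%:R * ((\sum_(u in z.2) w u) / perms).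
have mZ p : measurable_fibers (Z p).
  by apply: measurable_fibers_pair; [exact: measurable_fibers_sample_size | exact: measurable_fibers_output].
have g0 p z : 0 <= g p z.
  by rewrite mulr_ge0 // divr_ge0 ?ler0n // sumr_ge0.
have := expectation_sum_mean (seed_law A) mZ g0.
rewrite pair_bigA => <-; congr expectation; apply: boolp.funext => t.
rewrite -(pair_bigA _ (fun sigma j => g (sigma, j) (Z (sigma, j) t))) mulr_suml.
apply: eq_bigr => sigma _; rewrite [RHS](bigD1 (sample_size t)) //= [X in _ + X]big1 ?addr0.
  by rewrite /g eqxx mul1r.
by move=> j; rewrite /g eq_sym => /negPf /= ->; rewrite mul0r.
Qed.

(* The adversary that, on seeing a sample of size [j], minimizes the contribution
   of the seeds that request [j] elements; it is worse than any adaptive choice of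
   the order of the remaining elements. *)
Lemma robust_value (o : 'I_#|N|.+1 -> {perm N} -> seq N) :
  (forall j sigma, is_order (o j sigma)) ->
  (forall (j : 'I_#|N|.+1) sigma, take j (o j sigma) = take j (order_of sigma)) ->
  ((alpha * \sum_(u in OPT) w u)%:E <= expectation (seed_law A) (fun t =>
    ((\sum_(sigma : {perm N}) \sum_(u in output t (w : instance linear)
       (o (sample_size t) sigma)) w u) / perms)%R))%E.
Proof.
move=> oo ot; pose rest (p : seq N) := [seq u <- enum N | u \notin p].
(* The length of the sample [p] reveals the requested size, so the adversary can minimize for that
   size. *)
have ex p : exists q, perm_eq q (rest p) /\ forall q', perm_eq q' (rest p) ->
    value_at (inord (size p)) (p ++ q) <= value_at (inord (size p)) (p ++ q').
  have rp : rest p \in permutations (rest p) by rewrite mem_permutations.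
  have [q] := exists_seq_min (fun q => value_at (inord (size p)) (p ++ q)) rp.
  rewrite mem_permutations => pq minq; exists q; split=> // q' pq'.
  by apply: minq; rewrite mem_permutations.
have [adv advP] := boolp.choice ex.
apply: le_trans (value_A (adv := adv) _) _; first by move=> p; case: (advP p).
pose o' (j : 'I_#|N|.+1) (sigma : {perm N}) :=
  take j (order_of sigma) ++ adv (take j (order_of sigma)).
have -> : expected_value (A := A) (w : instance linear)
    (fun t s => take (m t) s ++ adv (take (m t) s)) =
  expectation (seed_law A) (fun t => ((\sum_(sigma : {perm N})
    \sum_(u in output t (w : instance linear)
      (o' (sample_size t) sigma)) w u) / perms)%R).
  by congr expectation; apply: boolp.funext => t; rewrite /o' val_sample_size.
rewrite !expected_value_at lee_fin.
apply: ler_sum => sigma _; apply: ler_sum => j _.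
have sj : size (take j (order_of sigma)) = j.
  by rewrite size_takel // order_size ?order_of_order // -ltnS.
have [_] := advP (take j (order_of sigma)); rewrite sj inord_val.
rewrite -[o j sigma in leRHS](cat_take_drop j) ot; apply.
have := order_uniq (oo j sigma); rewrite -{1}(cat_take_drop j (o j sigma)) cat_uniq.
move=> /and3P[_ /hasPn disj uq]; apply: uniq_perm => //.
  by rewrite filter_uniq ?enum_uniq.
move=> u; rewrite mem_filter mem_enum andbT -ot.
have := mem_order u (oo j sigma); rewrite -{1}(cat_take_drop j (o j sigma)) mem_cat.
case ud : (u \in drop j _); first by rewrite (disj _ ud).
by rewrite orbF => ->.
Qed.

End Robust.

Section Adversarial.
Variable N : finType.
Implicit Types (P : {set N}) (s : seq N).

(** The first [j] merged elements involve the sample and only as many later arrivals as there are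
    positions outside [P] among the first [j]. *)
Lemma interleave_take P s s' j :
  let i := (#|P| + count negb (take j (position_mask P)))%N in
  is_order s -> is_order s' -> (j <= #|N|)%N -> take i s = take i s' ->
  take j (interleave P s) = take j (interleave P s').
Proof.
set c := count negb _ => i os os' jN E.
have eP : take #|P| s = take #|P| s'.
  by rewrite -(take_takel s (leq_addr c #|P|)) E take_takel ?leq_addr.
have eb : take c (drop #|P| s) = take c (drop #|P| s').
  by rewrite !take_drop addnC E.
have cle : (c <= count negb (position_mask P))%N.
  by rewrite -(cat_take_drop j (position_mask P)) count_cat leq_addr.
rewrite /interleave -[drop #|P| s](cat_take_drop c) -[drop #|P| s'](cat_take_drop c).
rewrite eP eb.
have [z ->] := merge_mask_cat (position_mask P) (take #|P| s')
  (take c (drop #|P| s')) (drop c (drop #|P| s)).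
have [z' ->] := merge_mask_cat (position_mask P) (take #|P| s')
  (take c (drop #|P| s')) (drop c (drop #|P| s')).
have sz : (j <= size (merge_mask (position_mask P) (take #|P| s')
    (take c (drop #|P| s'))))%N.
  apply: size_merge_mask; rewrite ?size_position_mask //.
    by rewrite count_position_mask size_sample.
  rewrite size_takel // size_drop (order_size os').
  by rewrite -count_negb_position_mask.
by rewrite !takel_cat.
Qed.

Lemma splice_order (adv : seq N -> seq N) i s : adversary adv -> is_order s ->
  is_order (take i s ++ adv (take i s)).
Proof.
move=> hadv os; have us := order_uniq os.
have sadv := hadv (take i s).
apply: uniq_perm; rewrite ?enum_uniq //.
  rewrite cat_uniq take_uniq //= (perm_uniq sadv) filter_uniq ?enum_uniq // andbT.
  by apply/hasPn => u; rewrite (perm_mem sadv) mem_filter => /andP[].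
move=> u; rewrite mem_cat (perm_mem sadv) mem_filter mem_enum andbT.
by rewrite inE; case: (u \in take i s).
Qed.

End Adversarial.

Theorem theorem3 (R : realType) (N : finType) (k : nat) (hk : (0 < k)%N)
    (M : 'I_k -> matroid N) (alpha : R) (halpha : 0 <= alpha <= 1)
    (A : secretary_alg (linear_objective R N)) (hA : competitive M alpha A) :
  exists B : secretary_alg (submodular_objective R N),
    competitive M (alpha ^+ 2 / (128 * k%:R ^+ 2)) B /\
    (order_oblivious M alpha A ->
     order_oblivious M (alpha ^+ 2 / (128 * k%:R ^+ 2)) B).
Proof.
have [feasA valA] := hA; pose r : R := alpha / (4 * k%:R).
have r01 : 0 <= r <= 1.
  have k1 : 1 <= k%:R :> R by rewrite ler1n.
  case/andP: halpha => a0 a1; rewrite divr_ge0 /=; try lra.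
  by rewrite ler_pdivrMr; lra.
exists (lift M A r01); split.
  split; first exact: lift_feasible.
  move=> f [f0 sf] O [/cindepP cO _].
  (* Without an adversary, interleaving undoes [sample_first], so [A] sees the uniform order
     itself. *)
  apply: (@lift_value _ _ _ _ _ unit (fun=> tt) (fun _ _ s => s)) => //.
    exact: measurable_fibers_cst.
  move=> w OPT Q w0 hOPT; apply: le_trans (valA w w0 OPT hOPT) _.
  rewrite le_eqVlt; apply/orP; left; apply/eqP; congr expectation.
  apply: boolp.funext => t; congr (_ / _); apply: eq_bigr => sigma _.
  by rewrite /presented interleaveK // order_of_order.
move=> [_ [m [mm mN disjA oblA]]]; split; first exact: lift_feasible.
(* The new sample size covers the price sample and the later arrivals needed to fill the first [j]
   positions seen by [A]. *)
pose size_of (P : {set N}) j := (#|P| + count negb (take j (position_mask P)))%N.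
have cle (P : {set N}) j :
    (count negb (take j (position_mask P)) <= #|N| - #|P|)%N.
  rewrite -count_negb_position_mask -{2}(cat_take_drop j (position_mask P)).
  by rewrite count_cat leq_addr.
exists (fun t : seed A * nat => size_of (decode N t.2).1 (m t.1)); split.
- apply: measurable_slices => i /=.
  exact: (measurableT_comp (f := size_of (decode N i).1)).
- move=> t; apply: leq_trans (leq_add (leqnn _) (cle _ _)) _.
  by rewrite subnKC ?max_card.
- move=> f hf t s os; rewrite lift_output //.
  rewrite disjoint_sym disjoint_subset; apply/subsetP => u uS.
  set P := (decode N t.2).1 in uS *.
  rewrite !inE; apply/negP => /andP[/andP[/andP[uL _] _] uA].
  move: uS; rewrite /size_of takeD mem_cat (negPf uL) /= => ub.
  (* An element of the requested prefix outside [L] lies in the sample of [A], from which [A]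
     selects nothing. *)
  have uz : u \in take (m t.1) (interleave P s).
    by apply: take_merge_mask_sub ub; rewrite count_position_mask size_sample.
  have := disjA _ (sub_weight_ge0 M f [set v in take #|P| s] (decode N t.2).2) t.1 _
    (interleave_order P os).
  move/pred0P => /(_ u) /=; rewrite uz andbT.
  by move/negP; apply; rewrite inE.
move=> f [f0 sf] O [/cindepP cO _] adv hadv.
pose rho (j : 'I_#|N|.+1) P s := take (size_of P j) s ++ adv (take (size_of P j) s).
have ordered j P s : is_order s -> is_order (rho j P s) by apply: splice_order.
have take_rho (j : 'I_#|N|.+1) P s : is_order s ->
    take (size_of P j) (rho j P s) = take (size_of P j) s.
  move=> os; rewrite /rho takel_cat ?take_takel //.
  rewrite size_takel // order_size //; apply: leq_trans (leq_add (leqnn _) (cle _ _)) _.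
  by rewrite subnKC ?max_card.
have -> : (fun (t : seed (lift M A r01)) s =>
      take (size_of (decode N t.2).1 (m t.1)) s ++
      adv (take (size_of (decode N t.2).1 (m t.1)) s)) =
    (fun t s => rho (sample_size m t.1) (decode N t.2).1 s).
  by apply: boolp.funext => t; apply: boolp.funext => s; rewrite /rho val_sample_size.
apply: (@lift_value _ _ _ _ _ _ (sample_size m) rho) => //.
- exact: measurable_fibers_sample_size.
- move=> j P s os; rewrite -[LHS](take_takel _ (leq_addr (count negb (take j (position_mask P))) #|P|)).
  by rewrite take_rho // take_takel ?leq_addr.
move=> w OPT Q w0 hOPT.
(* The adversary acts beyond the requested prefix, so the first [j] elements presented to [A] are
   those of the uniform order. *)
apply: (robust_value mm mN w0 (fun adv hadv => oblA w w0 OPT hOPT adv hadv)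
  (o := fun j sigma => presented rho j (Q sigma) (order_of sigma))).
  by move=> j sigma; apply/interleave_order/ordered/sample_first_order/order_of_order.
move=> j sigma; have os := order_of_order sigma.
have os' := sample_first_order (Q sigma) os.
rewrite -[in RHS](interleaveK (Q sigma) os); apply: interleave_take => //.
- exact: ordered.
- by rewrite -ltnS.
exact: take_rho.
Qed.
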